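(* Let $\widehat{T}\in L(H)$ be an operator with spectrum $\sigma(\widehat{T})\subset\overline{\mathbb{D}}$. Suppose that $\gamma$ has the form $\gamma(t)=(1-t)^a\,\widetilde{\gamma}(t)$ for some $a>0$, where $(1-t)^a\in\mathcal{A}_{\widehat{T},\mathbb{R}}$ and $\widetilde{\gamma}\in\mathcal{A}_{\widehat{T},\mathbb{R}}^0$ satisfies $\widetilde{\gamma}(t)>0$ for all $t\in[0,1]$. If $\gamma(\widehat{T}^*,\widehat{T})\ge 0$, then $\widehat{T}$ is similar to an $a$-contraction.
   Context: $H$ is a separable Hilbert space, $L(H)$ is the algebra of bounded linear operators on $H$, and $\mathbb{D}=\{|t|<1\}$. $A_W$ is the Wiener algebra of analytic functions $\alpha(t)=\sum_{n\ge0}\alpha_n t^n$ on $\mathbb{D}$ with $\sum_n|\alpha_n|<\infty$. For $T\in L(H)$ with $\sigma(T)\subset\overline{\mathbb{D}}$: $\mathcal{A}_T$ is the set of $\alpha\in A_W$ such that $\sum_{n}|\alpha_n|T^{*n}T^n$ converges in the strong operator topology (SOT); $\mathcal{A}_T^0$ is the set of $\alpha\in A_W$ such that $\sum_n|\alpha_n|T^{*n}T^n$ converges in the operator norm of $L(H)$; $\mathcal{A}_{T,\mathbb{R}}$ and $\mathcal{A}_{T,\mathbb{R}}^0$ are the subsets of functions in $\mathcal{A}_T$ and $\mathcal{A}_T^0$, respectively, with real Taylor coefficients. For a power series $\alpha(t)=\sum_n\alpha_nt^n$, $\alpha(T^*,T):=\sum_{n=0}^\infty\alpha_nT^{*n}T^n$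 whenever this series converges in SOT (in particular it is well defined for $\alpha\in\mathcal{A}_{T,\mathbb{R}}$). An operator $T$ is an $a$-contraction ($a>0$) if, with $\alpha(t)=(1-t)^a$, the series defining $\alpha(T^*,T)$ converges in SOT and $\alpha(T^*,T)\ge0$. *)

(* Defs.v *)
From HB Require Import structures.
From mathcomp Require Import all_boot all_order all_algebra.
From mathcomp Require Import complex.
From mathcomp Require Import all_classical all_reals all_analysis.

Set Implicit Arguments.
Unset Strict Implicit.
Unset Printing Implicit Defensive.

Import Order.TTheory GRing.Theory Num.Theory.
Import numFieldNormedType.Exports.

Local Open Scope classical_set_scope.
Local Open Scope ring_scope.
Local Open Scope complex_scope.

Section ComplexFunctions.
Variable R : realType.
Implicit Types (f : R[i] -> R[i]) (c : nat -> R[i]) (t z : R[i]) (a : R).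

(* Principal argument, in ]-pi, pi]; its value at 0 is irrelevant. *)
Definition carg z : R :=
  let theta := acos (complex.Re z / complex.Re `|z|) in
  if complex.Im z < 0 then - theta else theta.

Definition cpow z a : R[i] :=
  (complex.Re `|z| `^ a)%:C * (cos (a * carg z) +i* sin (a * carg z)).

Definition one_sub_pow a : R[i] -> R[i] := fun t => cpow (1 - t) a.

(* The type R[i] itself is neither topological nor pointed; R[i]^o is. *)
Definition sums_to c t z : Prop :=
  (series (fun n => c n * t ^+ n) : nat -> R[i]^o) @ \oo --> (z : R[i]^o).

(* The Taylor coefficients at 0 of a function analytic on the open unit disc,
   which are determined by its values there. *)
Definition taylor f : nat -> R[i] :=
  get [set c : nat -> R[i]^o | forall t, `|t| < 1 -> sums_to c t (f t)].

(* An element of the Wiener algebra extends continuously to the closed disc by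
   the sum of its series; it is identified with this extension, so that its
   value at 1 makes sense. *)
Definition wiener : set (R[i] -> R[i]) :=
  [set f | (forall t, `|t| <= 1 -> sums_to (taylor f) t (f t)) /\
           cvgn (series (fun n => complex.Re `|taylor f n|))].

Definition real_coef : set (R[i] -> R[i]) :=
  [set f | forall n, taylor f n \is Num.real].

End ComplexFunctions.

Section Operators.
Variables (R : realType) (H : completeNormedModType R[i]).
Variable dot : {dot H for Num.conj}.
Implicit Types (T S A : H -> H) (P : nat -> H -> H) (f : R[i] -> R[i]).
Implicit Types (c : nat -> R[i]) (a : R).

Definition inner_product_norm : Prop := forall x : H, `|x| ^+ 2 = dot x x.

Definition separable_space : Prop := exists2 D : set H, countable D & dense D.

Definition bounded_op T : Prop := linear T /\ continuous T.

Definition op_inverse T S : Prop :=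
  [/\ bounded_op T, bounded_op S, cancel T S & cancel S T].

Definition op_spectrum T : set R[i] :=
  [set l | ~ exists S, op_inverse (fun x => T x - l *: x) S].

Definition op_similar T S : Prop :=
  exists L Li, op_inverse L Li /\ S = L \o T \o Li.

(* Such an S is unique; for bounded T it exists by Riesz representation. *)
Definition op_adjoint T : H -> H :=
  get [set S | forall x y, dot (T x) y = dot x (S y)].

(* Over R[i], 0 <= z includes that z is real. *)
Definition op_nonneg A : Prop := forall x, 0 <= dot (A x) x.

Definition op_norm A : R :=
  sup [set complex.Re `|A x| | x in [set x | `|x| <= 1]].

Definition sot_cvg P : Prop :=
  exists A, bounded_op A /\ forall x, (P n x @[n --> \oo]) --> A x.

Definition norm_cvg P : Prop :=
  exists A, bounded_op A /\
    (op_norm (fun x => P n x - A x) @[n --> \oo]) --> (0 : R).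

(* Partial sums of \sum_n c_n T^*n T^n *)
Definition hereditary_sum c T (N : nat) : H -> H :=
  fun x => series (fun n => c n *: iter n (op_adjoint T) (iter n T x)) N.

(* f(T^*, T); meaningful when the partial sums converge strongly. *)
Definition hereditary f T : H -> H :=
  fun x => limn (fun N => hereditary_sum (taylor f) T N x).

Definition class_A T : set (R[i] -> R[i]) :=
  [set f | wiener f /\ sot_cvg (hereditary_sum (fun n => `|taylor f n|) T)].

Definition class_A0 T : set (R[i] -> R[i]) :=
  [set f | wiener f /\ norm_cvg (hereditary_sum (fun n => `|taylor f n|) T)].

Definition class_AR T := class_A T `&` @real_coef R.

Definition class_A0R T := class_A0 T `&` @real_coef R.

Definition a_contraction a T : Prop :=
  [/\ bounded_op T,
      sot_cvg (hereditary_sum (taylor (one_sub_pow a)) T) &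
      op_nonneg (hereditary (one_sub_pow a) T)].

End Operators.

(* Main.v *)
(* Let alpha_n be the Taylor coefficients of (1 - t)^a, and gamma = (1 - t)^a g.
   Suppose P has nonnegative coefficients, P_0 > 0, P(T^*, T) converges and P g has
   nonnegative coefficients.  Then B = (P g)(T^*, T) is bounded, and bounded below by
   a positive constant.  Writing B = L^* L, the operator S = L T L^-1 satisfies, with
   y = L^-1 x,
     sum_n alpha_n |S^n x|^2 = <(P gamma)(T^*, T) y, y>
                             = sum_n P_n <gamma(T^*, T) T^n y, T^n y> >= 0.
   To find P, split g = (q - d) + (d + r), where r is a tail of g, small in the
   norm of A_T^0, and q - d is a polynomial positive on [0, 1].  The summand d + r
   is multiplied by s = (1 - r^- / d)^-1, where r^- is minus the part of r with
   negative coefficients.  The polynomial is factored into linear and quadratic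
   factors: a root z > 1 is cancelled by 1 / (1 - t / z), which is where the spectral
   radius of T enters, and a pair of conjugate roots is treated by repeatedly
   multiplying by the factor with opposite linear term, which doubles the argument
   of the roots until their real part becomes nonpositive. *)
Require Import Defs.
From HB Require Import structures.
From mathcomp Require Import all_boot all_order all_algebra.
From mathcomp Require Import complex.
From mathcomp Require Import all_classical all_reals all_analysis.
From mathcomp Require Import ring lra zify.

Set Implicit Arguments.
Unset Strict Implicit.
Unset Printing Implicit Defensive.

Import Order.TTheory GRing.Theory Num.Theory.
Import numFieldNormedType.Exports.

Local Open Scope classical_set_scope.
Local Open Scope ring_scope.
Local Open Scope complex_scope.

(** * Cauchy products of real sequences *)

Section Convolution.
Variable R : realType.
Implicit Types (f g h u e : nat -> R) (p q : {poly R}).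

(** The reciprocal of g would be the obvious P, but g may vanish in the disc away from [0, 1]. The
    aim is therefore only that P g has nonnegative coefficients: as T^*n T^n >= 0, its hereditary
    sum is then bounded below by its term n = 0, which is P_0 g_0. The classes enter through scalar
    sums: [hbnd T f K] bounds sum_n |f_n| |T^n x|^2 by K |x|^2. Such bounds multiply under Cauchy
    products, because the inner sum can be estimated at the vector T^k x, and they give back strong
    convergence. Norm convergence of the series for g makes the bound of its tails small uniformly
    in x, so that r^- / d has bound 1/2 and s has bound 2. The powers of T may be unbounded, so 1 /
    (1 - t / z) with z > 1 requires |T^n| = O(r^-n) for every r < 1. This is extracted from the
    spectrum by averaging resolvents over roots of unity and by increasing the radius in finitely
    many small steps. *)

Definition cprod f g : nat -> R := fun n => \sum_(k < n.+1) f k * g (n - k)%N.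

Lemma cprod_coef p q : cprod (fun n => p`_n) (fun n => q`_n) = fun n => (p * q)`_n.
Proof. by apply/funext => n; rewrite coefM. Qed.

(** A coefficient involves finitely many terms, so commutativity and associativity are inherited
    from [{poly R}] by truncation. *)
Lemma cprod_poly f g N n : (n < N)%N ->
  cprod f g n = ((\poly_(i < N) f i) * (\poly_(i < N) g i))`_n.
Proof.
move=> nN; rewrite coefM; apply: eq_bigr => k _.
rewrite !coef_poly (leq_ltn_trans (leq_ord k) nN).
by rewrite (leq_ltn_trans (leq_subr _ _) nN).
Qed.

Lemma cprodC f g : cprod f g = cprod g f.
Proof. by apply/funext => n; rewrite !(cprod_poly _ _ (ltnSn n)) mulrC. Qed.

Lemma cprodDr f g h : cprod f (fun n => g n + h n) = fun n => cprod f g n + cprod f h n.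
Proof.
apply/funext => n; rewrite /cprod -big_split; apply: eq_bigr => k _.
by rewrite mulrDr.
Qed.

Lemma cprodA f g h : cprod f (cprod g h) = cprod (cprod f g) h.
Proof.
have coefMlow (p q q' : {poly R}) n : (forall k, (k <= n)%N -> q`_k = q'`_k) ->
    (p * q)`_n = (p * q')`_n.
  move=> qq'; rewrite !coefM; apply: eq_bigr => k _.
  by rewrite qq' ?leq_subr.
have eqp f' g' n k : (k <= n)%N -> (\poly_(i < n.+1) cprod f' g' i)`_k =
   ((\poly_(i < n.+1) f' i) * (\poly_(i < n.+1) g' i))`_k.
  by move=> kn; rewrite coef_poly ltnS kn (cprod_poly _ _ (_ : k < n.+1)%N).
apply/funext => n; rewrite !(cprod_poly _ _ (ltnSn n)).
rewrite (coefMlow _ _ _ n (eqp g h n)) mulrA mulrC.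
by rewrite -(coefMlow _ _ _ n (eqp f g n)) mulrC.
Qed.

Lemma cprod_ge0 f g : (forall n, 0 <= f n) -> (forall n, 0 <= g n) ->
  forall n, 0 <= cprod f g n.
Proof. by move=> f0 g0 n; apply: sumr_ge0 => k _; apply: mulr_ge0. Qed.

Lemma cprod_at0 f g : cprod f g 0%N = f 0%N * g 0%N.
Proof. by rewrite /cprod big_ord1. Qed.

Lemma sum_triangle (V : zmodType) (F : nat -> nat -> V) N :
  \sum_(n < N) \sum_(k < n.+1) F k (n - k)%N = \sum_(k < N) \sum_(m < N - k) F k m.
Proof.
elim: N => [|N IH]; first by rewrite !big_ord0.
rewrite big_ord_recr /= IH [RHS]big_ord_recr /= subSnn big_ord1.
rewrite big_ord_recr /= subnn addrA; congr (_ + _).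
rewrite -big_split; apply: eq_bigr => k _ /=.
by rewrite subSn ?big_ord_recr //= ltnW.
Qed.

Lemma sum_cprod f g u N : \sum_(n < N) cprod f g n * u n =
  \sum_(k < N) \sum_(m < N - k) f k * g m * u (k + m)%N.
Proof.
rewrite -(sum_triangle (fun k m => f k * g m * u (k + m)%N)).
apply: eq_bigr => n _; rewrite /cprod mulr_suml; apply: eq_bigr => k _.
by rewrite subnKC // leq_ord.
Qed.

Lemma sum_prefix_split (v : nat -> R) m n : (m <= n)%N ->
  \sum_(i < n) v i = \sum_(i < m) v i + \sum_(m <= i < n) v i.
Proof.
by move=> mn; rewrite -!(big_mkord xpredT v) (big_cat_nat_idem _ (leq0n m) mn) //= addr0.
Qed.

Lemma ler_sum_prefix (v : nat -> R) m n : (forall i, 0 <= v i) -> (m <= n)%N ->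
  \sum_(i < m) v i <= \sum_(i < n) v i.
Proof. by move=> v0 mn; rewrite (sum_prefix_split _ mn) lerDl sumr_ge0. Qed.

Lemma sum_triangle_ge_square (F : nat -> nat -> R) M N :
  (forall k m, 0 <= F k m) -> (M + M <= N)%N ->
  \sum_(k < M) \sum_(m < M) F k m <= \sum_(k < N) \sum_(m < N - k) F k m.
Proof.
move=> F0 MN; apply: (@le_trans _ _ (\sum_(k < M) \sum_(m < N - k) F k m)).
  by apply: ler_sum => k _; apply: ler_sum_prefix => //; have := ltn_ord k; lia.
by apply: (@ler_sum_prefix (fun k => \sum_(m < N - k) F k m)); [move=> k; exact: sumr_ge0 | lia].
Qed.

Lemma cvg_norm_le (v : nat -> R) l (e : R) N : v @ \oo --> l ->
  (forall M, (N <= M)%N -> `|v M| <= e) -> `|l| <= e.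
Proof.
move=> vl ve; have vl' : `|v n| @[n --> \oo] --> `|l| by exact: cvg_norm.
have ve' : \forall n \near \oo, `|v n| <= e by exists N.
exact: (cvgr_to_le vl' ve').
Qed.

(* The error is a sum over the part of a large square lying outside the
   triangle, which itself contains a smaller square. *)
Lemma cvg_sum_triangle (F : nat -> nat -> R) (s : nat -> R) (C : R) :
  (forall N, \sum_(k < N) \sum_(m < N) `|F k m| <= C) ->
  (forall k, (fun M => \sum_(m < M) F k m) @ \oo --> s k) ->
  (fun N => \sum_(k < N) s k - \sum_(k < N) \sum_(m < N - k) F k m) @ \oo --> 0.
Proof.
move=> FC Fs.
pose sq N := \sum_(k < N) \sum_(m < N) `|F k m|.
have sqnd : {homo sq : n m / (n <= m)%N >-> n <= m}.
  move=> n m nm; apply: (@le_trans _ _ (\sum_(k < n) \sum_(i < m) `|F k i|)).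
    by apply: ler_sum => k _; apply: (ler_sum_prefix (fun i => normr_ge0 (F k i))).
  by apply: (@ler_sum_prefix (fun k => \sum_(i < m) `|F k i|)) => // k; exact: sumr_ge0.
have sqc : cvgn sq.
  by apply: nondecreasing_is_cvgn => //; exists C => _ [n _ <-]; exact: FC.
have sql n : sq n <= limn sq by apply: nondecreasing_cvgn_le.
apply/cvgrPdist_le => eps eps0.
have /cvgrPdist_lt /(_ _ eps0) [N0 _ sqN0] : sq @ \oo --> limn sq by [].
exists (N0 + N0)%N => // N /= NN0.
rewrite sub0r normrN.
(* The limits [s k] are replaced by sums over m < M with M >= N; the resulting bound
   [limn sq - sq N0] does not depend on M. *)
have lim1 : (fun M => \sum_(k < N) (\sum_(m < M) F k m - \sum_(m < N - k) F k m)) @ \oo -->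
    \sum_(k < N) s k - \sum_(k < N) \sum_(m < N - k) F k m.
  rewrite -sumrB; apply: cvg_big => [|k _]; [exact: add_continuous|].
  by apply: cvgB; [exact: Fs | exact: cvg_cst].
apply: (cvg_norm_le lim1 (N := N)) => M NM.
apply: (@le_trans _ _ (\sum_(k < N) (\sum_(m < M) `|F k m| - \sum_(m < N - k) `|F k m|))).
  apply: le_trans (ler_norm_sum _ _ _) _; apply: ler_sum => k _.
  have NkM : (N - k <= M)%N by apply: leq_trans NM; exact: leq_subr.
  rewrite (sum_prefix_split (F k) NkM) (sum_prefix_split (fun m => `|F k m|) NkM).
  by rewrite addrAC subrr add0r [leRHS]addrAC subrr add0r ler_norm_sum.
rewrite sumrB.
have h1 : sq N0 <= \sum_(k < N) \sum_(m < N - k) `|F k m|.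
  by apply: (@sum_triangle_ge_square (fun k m => `|F k m|)).
have h2 : \sum_(k < N) \sum_(m < M) `|F k m| <= sq M.
  by apply: (@ler_sum_prefix (fun k => \sum_(m < M) `|F k m|)) => // k; exact: sumr_ge0.
have h3 := sql M; have := sqN0 _ (leqnn N0); rewrite ger0_norm ?subr_ge0 //.
by move=> h4; lra.
Qed.

(** Coefficients of 1 / (1 - e(t)), from s = 1 + e s. Each coefficient depends on all the earlier
    ones, so the recursion runs on the list of the first n + 1 of them. *)
Lemma cprod_inverse e : e 0%N = 0 -> (forall n, 0 <= e n) ->
  exists s, [/\ s 0%N = 1, forall n, 0 <= s n & forall n, s n.+1 = cprod e s n.+1].
Proof.
move=> e0 ege.
pose step (l : seq R) := rcons l (\sum_(k < size l) e k.+1 * nth 0 l (size l - k.+1)).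
pose l n := iter n step [:: 1].
have sl n : size (l n) = n.+1 by elim: n => //= n IH; rewrite size_rcons IH.
have ln n m k : (k <= n)%N -> nth 0 (l (n + m)%N) k = nth 0 (l n) k.
  move=> kn; elim: m => [|m IH]; first by rewrite addn0.
  by rewrite addnS /= nth_rcons sl ltnS (leq_trans kn (leq_addr _ _)) IH.
pose s n := nth 0 (l n) n.
have sS n : s n.+1 = \sum_(k < n.+1) e k.+1 * s (n - k)%N.
  rewrite {1}/s /= nth_rcons sl ltnn eqxx; apply: eq_bigr => k _.
  have kn := leq_ord k.
  rewrite subSS; have -> : l n = l (n - k + k)%N by rewrite subnK.
  by rewrite ln.
exists s; split=> // [n|n]; last by rewrite /cprod big_ord_recl e0 mul0r add0r sS.
elim/ltn_ind: n => -[|n] IH; first exact: ler01.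
rewrite sS; apply: sumr_ge0 => k _; apply: mulr_ge0 => //; apply: IH.
by rewrite ltnS leq_subr.
Qed.

End Convolution.

(** * Polynomials positive on [0, 1] *)

Section PositivePolynomials.
Variables (R : realType) (adm : (nat -> R) -> Prop).
Hypothesis admM : forall f g, adm f -> adm g -> adm (cprod f g).
Hypothesis admP : forall p : {poly R}, adm (fun n => p`_n).
Hypothesis admG : forall z : R, 1 < z -> adm (fun n => z^-1 ^+ n).
Implicit Types (p q : {poly R}).

(** [adm] will be the existence of a bound [hbnd T f K]. Since [good] is multiplicative, it can be
    checked on the factors of a polynomial. *)
Let good q := exists f, [/\ adm f, forall n, 0 <= f n, 0 < f 0%N &
  forall n, 0 <= cprod f (fun k => q`_k) n].

Let good_mul q1 q2 : good q1 -> good q2 -> good (q1 * q2).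
Proof.
move=> [f1 [a1 f1p f10 c1]] [f2 [a2 f2p f20 c2]]; exists (cprod f1 f2); split.
- exact: admM.
- exact: cprod_ge0.
- by rewrite cprod_at0 mulr_gt0.
- have -> : cprod (cprod f1 f2) (fun k => (q1 * q2)`_k) =
      cprod (cprod f1 (fun k => q1`_k)) (cprod f2 (fun k => q2`_k)).
    rewrite -(cprod_coef q1 q2) -!cprodA; congr (cprod f1 _).
    by rewrite !cprodA (cprodC f2).
  exact: cprod_ge0.
Qed.

Let good_ge0 q : (forall n, 0 <= q`_n) -> good q.
Proof.
move=> q0; exists (fun n => (1%:P : {poly R})`_n); split=> //.
- by move=> n; rewrite coefC; case: ifP.
- by rewrite coefC.
- by move=> n; rewrite cprod_coef mul1r.
Qed.

Let good_root z : 1 < z -> good (z%:P - 'X).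
Proof.
move=> z1; have z0 : 0 < z by lra.
exists (fun n => z^-1 ^+ n); split=> //.
- exact: admG.
- by move=> n; rewrite exprn_ge0 // invr_ge0 ltW.
- move=> [|n]; rewrite cprodC /cprod.
    by rewrite big_ord1 coefB coefC coefX /= subr0 mulr1 ltW.
  rewrite !big_ord_recl big1 => [|k _]; last by rewrite coefB coefC coefX /= subr0 mul0r.
  rewrite addr0 !coefB !coefC !coefX /= !subn0 subSS subn0 exprS.
  by rewrite subr0 sub0r mulrA mulfV ?gt_eqF // mul1r mulN1r subrr.
Qed.

(** A quadratic in u = t^m: the product with the factor where [c] is negated is (u^2 + d)^2 - c^2
    u^2, again of this form with m doubled. *)
Let quad m (c d : R) : {poly R} := 'X^(m + m) - c *: 'X^m + d%:P.

Let quad_ge0 m c d : c <= 0 -> 0 <= d -> forall n, 0 <= (quad m c d)`_n.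
Proof.
move=> c0 d0 n; rewrite !coefD coefN coefZ !coefXn coefC -mulNr.
by rewrite !addr_ge0 ?mulr_ge0 ?oppr_ge0 //; case: ifP.
Qed.

Let quad_mul m c d :
  quad m c d * quad m (- c) d = quad (m + m) (c ^+ 2 - d *+ 2) (d ^+ 2).
Proof.
rewrite /quad -!mul_polyC !rmorphB !rmorphN !rmorphXn rmorphMn /= !exprD.
by ring.
Qed.

(* Multiplying by the polynomial with [c] negated replaces the angle
   [arccos (c / (2 sqrt d))] of the complex roots by its double. *)
Let good_quad_step j : forall m c d, 0 < d -> c ^+ 2 <= (4 - 4 / 2 ^+ j) * d ->
  good (quad m c d).
Proof.
(* As c > 0, the partner [quad m (- c) d] has nonnegative coefficients and may be absorbed into the
   multiplier. *)
have quadN m c d : 0 < c -> 0 < d ->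
    good (quad m c d * quad m (- c) d) -> good (quad m c d).
  move=> c0 d0 [f [af fp f0 cf]].
  exists (cprod f (fun n => (quad m (- c) d)`_n)).
  have qp n : 0 <= (quad m (- c) d)`_n by apply: quad_ge0; lra.
  split.
  - exact/admM.
  - exact: cprod_ge0.
  - rewrite cprod_at0 mulr_gt0 // lt_def qp andbT.
    case: m {cf qp} => [|m]; rewrite !coefD coefN coefZ !coefXn coefC /=.
      by rewrite gt_eqF //; lra.
    by rewrite gt_eqF //; lra.
  - by rewrite -cprodA cprod_coef mulrC.
elim: j => [|j IH] m c d d0 cd.
  apply: good_ge0; apply: quad_ge0; last exact: ltW.
  move: cd; rewrite expr0 divr1 subrr mul0r => cd.
  by have := sqr_ge0 c; nra.
have [c0|c0] := lerP c 0; first by apply: good_ge0; apply: quad_ge0 => //; exact: ltW.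
apply: quadN => //; rewrite quad_mul.
have [c1|c1] := lerP (c ^+ 2 - d *+ 2) 0.
  by apply: good_ge0; apply: quad_ge0 => //; exact: sqr_ge0.
apply: IH; first exact: exprn_gt0.
(* The hypothesis reads c^2 <= (4 - 2 w) d, hence c^2 - 2 d <= (2 - 2 w) d, whose square is at most
   (4 - 4 w) d^2 because w <= 1. This is the bound required for [j]. *)
set w := (2 ^+ j)^-1.
have w1 : 0 < w <= 1.
  by rewrite invr_gt0 exprn_gt0 //= invf_le1 ?exprn_gt0 // exprn_ege1 // ler1n.
have cd' : c ^+ 2 - d *+ 2 <= (2 - 2 * w) * d.
  move: cd; rewrite (exprS 2 j) invfM -/w; rewrite -mulr_natr; lra.
apply: (@le_trans _ _ (((2 - 2 * w) * d) ^+ 2)).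
  by rewrite lerXn2r // nnegrE ltW // (lt_le_trans c1).
rewrite exprMn ler_wpM2r ?sqr_ge0 //; nra.
Qed.

(** The discriminant c^2 - 4 d is negative, and j doublings suffice as soon as 4 d / 2^j < 4 d -
    c^2. *)
Let good_quad c d : c ^+ 2 < 4 * d -> good (quad 1 c d).
Proof.
move=> cd; have d0 : 0 < d by have := sqr_ge0 c; lra.
have [j jd] : exists j, 4 * d / (4 * d - c ^+ 2) < j%:R.
  exists (Num.bound (4 * d / (4 * d - c ^+ 2))); apply: archi_boundP.
  by rewrite divr_ge0 //; lra.
apply: (@good_quad_step j) => //.
have j2 : 4 * d / (4 * d - c ^+ 2) < 2 ^+ j.
  by apply: lt_trans jd _; rewrite -natrX ltr_nat ltn_expl.
have : 4 * d / 2 ^+ j < 4 * d - c ^+ 2.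
  move: j2; rewrite !ltr_pdivrMr ?exprn_gt0 //; last by lra.
  by move=> j2; rewrite (mulrC (4 * d - c ^+ 2)).
by rewrite mulrBl mulrAC => ?; lra.
Qed.

(** Induction on the size, removing a real root or a conjugate pair. Every factor removed is
    positive on [0, 1], hence so is the cofactor. *)
Lemma positive_poly_multiplier q : (forall t, 0 <= t <= 1 -> 0 < q.[t]) ->
  exists f, [/\ adm f, forall n, 0 <= f n, 0 < f 0%N &
    forall n, 0 <= cprod f (fun k => q`_k) n].
Proof.
rewrite -/(good q); elim: {q}_.+1 {-2}q (ltnSn (size q)) => // N IH q.
rewrite ltnS => sq q0.
have qn0 : q != 0.
  by apply/eqP => qE; have := q0 0; rewrite qE horner0 ltxx lexx ler01 => /(_ isT).
have [s1|s1] := leqP (size q) 1%N.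
  rewrite (size1_polyC s1); apply: good_ge0 => n.
  rewrite coefC; case: ifP => // _.
  by have := q0 0; rewrite {1}(size1_polyC s1) hornerC lexx ler01 => /(_ isT)/ltW.
have size_factor q1 q2 : q = q1 * q2 -> (1 < size q2)%N -> (size q1 < N)%N.
  move=> qE s2; move: sq qn0; rewrite qE mulf_eq0 negb_or => sq /andP[n1 n2].
  rewrite size_mul // in sq; move: (size q1) (size q2) sq s2 => a b; lia.
have [z rz] : exists z, root (map_poly (real_complex R) q) z.
  by apply: closed_rootP; rewrite size_map_poly; case: (size q) s1 => [|[]].
case: z rz => x y rz; have [y0|y0] := eqVneq y 0.
  have rx : root q x by move: rz; rewrite y0 complexr0 fmorph_root.
  have [q' qE] := factor_theorem _ _ rx.
  have [x0|x0] := ltP x 0.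
    rewrite qE; apply: good_mul; last first.
      apply: good_ge0 => n; rewrite coefB coefX coefC addr_ge0 //.
      by case: ifP; rewrite ?oppr0 ?oppr_ge0 // ltW.
    apply: IH; first by apply: size_factor qE _; rewrite size_XsubC.
    move=> t t01; have := q0 t t01; rewrite qE hornerM hornerXsubC pmulr_lgt0 //.
    by lra.
  have [x1|x1] := ltP 1 x; last by have := q0 x; rewrite x0 x1 (rootP rx) ltxx => /(_ isT).
  (* Both factors change sign, so that x - t, and with it the cofactor, is positive on [0, 1]. *)
  have qE' : q = (- q') * (x%:P - 'X) by rewrite qE mulNr -mulrN opprB.
  rewrite qE'; apply: good_mul (good_root x1).
  apply: IH; first by apply: size_factor qE' _; rewrite -opprB size_polyN size_XsubC.
  move=> t t01; have := q0 t t01; rewrite qE' hornerM !hornerE pmulr_lgt0 //.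
  by lra.
have y20 : 0 < y ^+ 2 by rewrite lt_def sqrf_eq0 y0 sqr_ge0.
set m := quad 1 (x *+ 2) (x ^+ 2 + y ^+ 2).
have sm : size m = 3%N.
  rewrite /m /quad -addrA size_polyDl size_polyXn // ltnS.
  rewrite (leq_trans (size_polyD _ _)) // geq_max size_polyN.
  rewrite (leq_trans (size_scale_leq _ _)) ?size_polyXn //=.
  by rewrite (leq_trans (size_polyC_leq1 _)).
have mn0 : m != 0 by rewrite -size_poly_eq0 sm.
have qE : q = (q %/ m) * m.
  have rmz : (map_poly (real_complex R) m).[x +i* y] = 0.
    rewrite /m /quad rmorphD rmorphB /= map_polyZ !map_polyXn map_polyC /=.
    rewrite !hornerE /=; apply/eqP; rewrite eq_complex /=.
    by apply/andP; split; apply/eqP; ring.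
  (* The remainder is real, of degree at most 1, and vanishes at a nonreal point, so it is zero. *)
  have := divp_eq q m; set r := q %% m => qE.
  have sr : (size r <= 2)%N by have := ltn_modp q m; rewrite mn0 sm.
  have rE : r = r`_1 *: 'X + (r`_0)%:P.
    apply/polyP => n; rewrite coefD coefZ coefX coefC.
    case: n => [|[|n]] /=; rewrite ?mulr0 ?mulr1 ?add0r ?addr0 //.
    by rewrite nth_default // (leq_trans sr).
  have : (map_poly (real_complex R) r).[x +i* y] = 0.
    have : map_poly (real_complex R) q = map_poly (real_complex R) (q %/ m * m + r) by rewrite -qE.
    rewrite rmorphD rmorphM /= => /(congr1 (fun p : {poly R[i]} => p.[x +i* y])).
    by rewrite (rootP rz) hornerD hornerM rmz mulr0 add0r => <-.
  rewrite rE rmorphD /= map_polyZ map_polyX map_polyC /= !hornerE.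
  move=> /eqP; rewrite eq_complex /= !mul0r !addr0 subr0.
  move=> /andP[/eqP r0 /eqP r1].
  have r10 : r`_1 = 0 by move/eqP: r1; rewrite mulf_eq0 (negbTE y0) orbF => /eqP.
  move: r0; rewrite r10 mul0r add0r => r00.
  by rewrite {1}qE rE r10 r00 scale0r !addr0.
rewrite qE; apply: good_mul; last first.
  by apply: good_quad; rewrite -(mulr_natr x 2) exprMn; lra.
apply: IH; first by apply: size_factor qE _; rewrite sm.
move=> t t01; have := q0 t t01; rewrite {1}qE hornerM pmulr_lgt0 //.
rewrite /m /quad !hornerE /=.
by have := sqr_ge0 (t - x); rewrite -mulr_natr; nra.
Qed.

End PositivePolynomials.

(** * Real-valued norms, bounded operators and the Neumann series *)

Section HilbertSpace.
Variables (R : realType) (H : completeNormedModType R[i]).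

Lemma ReD (z w : R[i]) : complex.Re (z + w) = complex.Re z + complex.Re w.
Proof. by case: z w => [? ?] []. Qed.

Lemma ReN (z : R[i]) : complex.Re (- z) = - complex.Re z.
Proof. by case: z. Qed.

Lemma Re_rM (c : R) (z : R[i]) : complex.Re (c%:C * z) = c * complex.Re z.
Proof. by case: z => x y /=; rewrite mul0r subr0. Qed.

Lemma normcR (c : R) : `|c%:C| = `|c|%:C.
Proof. by rewrite normc_def /= expr0n addr0 sqrtr_sqr. Qed.

Lemma Re_normc_le (x y : R) : complex.Re `|x +i* y| <= `|x| + `|y|.
Proof.
rewrite normc_def /= -(ger0_norm (addr_ge0 (normr_ge0 x) (normr_ge0 y))) -sqrtr_sqr.
rewrite ler_wsqrtr // -(real_normK (num_real x)) -(real_normK (num_real y)).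
by have := mulr_ge0 (normr_ge0 x) (normr_ge0 y); nra.
Qed.

Lemma normr_Re_le (z : R[i]) : `|complex.Re z| <= complex.Re `|z|.
Proof. by rewrite -lecR RRe_real ?normr_real // normc_ge_Re. Qed.

Lemma Re_normc_ge0 (z : R[i]) : 0 <= complex.Re `|z|.
Proof. by rewrite -ler0c RRe_real ?normr_real. Qed.

(** The norm of [H] takes values in [R[i]]; its real part places all estimates in the totally
    ordered field [R]. *)
Definition rnorm (x : H) : R := complex.Re `|x|.

Lemma rnormE (x : H) : `|x| = (rnorm x)%:C.
Proof. by rewrite RRe_real // normr_real. Qed.

Lemma rnorm_ge0 x : 0 <= rnorm x.
Proof. by rewrite -ler0c -rnormE. Qed.

Lemma ler_rnormD x y : rnorm (x + y) <= rnorm x + rnorm y.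
Proof. by rewrite -lecR rmorphD /= -!rnormE ler_normD. Qed.

Lemma rnormN x : rnorm (- x) = rnorm x.
Proof. by rewrite /rnorm normrN. Qed.

Lemma ler_rnormB x y : rnorm (x - y) <= rnorm x + rnorm y.
Proof. by rewrite -(rnormN y) ler_rnormD. Qed.

Lemma rnormBC x y : rnorm (x - y) = rnorm (y - x).
Proof. by rewrite -opprB rnormN. Qed.

Lemma rnorm0 : rnorm 0 = 0.
Proof. by rewrite /rnorm normr0. Qed.

Lemma rnorm_eq0 x : rnorm x = 0 -> x = 0.
Proof. by move=> x0; apply/normr0_eq0; rewrite rnormE x0. Qed.

Lemma rnormZ (c : R[i]) x : rnorm (c *: x) = complex.Re `|c| * rnorm x.
Proof.
apply: complexI; rewrite -rnormE normrZ rnormE rmorphM /=.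
by rewrite (_ : (Normc.normc c)%:C = `|c|).
Qed.

Lemma rnormZr (c : R) x : rnorm (c%:C *: x) = `|c| * rnorm x.
Proof. by rewrite rnormZ normcR. Qed.

Lemma cvg_rnormP (u : nat -> H) l : u @ \oo --> l <->
  (forall e : R, 0 < e -> exists N, forall n, (N <= n)%N -> rnorm (u n - l) <= e).
Proof.
split=> [/cvgrPdist_le ul e e0|h].
  have /ul [N _ h] : 0 < e%:C by rewrite ltcR.
  by exists N => n /h /=; rewrite distrC rnormE lecR.
apply/cvgrPdist_le => e e0.
have eE : e = (complex.Re e)%:C by rewrite RRe_real // gtr0_real.
move: e0; rewrite eE ltcR => /h [N hN]; exists N => // n /hN /=.
by rewrite -lecR -rnormE distrC.
Qed.

Lemma rnorm_complete (u : nat -> H) :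
  (forall e : R, 0 < e -> exists N, forall n, (N <= n)%N -> rnorm (u n - u N) <= e) ->
  exists l : H, u @ \oo --> l.
Proof.
move=> uC; suff /cauchy_cvgP uc : cauchy (u @ \oo) by exists (limn u).
apply: cauchy_exP => e e0.
have eE : e = (complex.Re e)%:C by rewrite RRe_real // gtr0_real.
move: e0; rewrite eE ltcR => e0.
have [|N hN] := uC (complex.Re e / 2); first by rewrite divr_gt0.
exists (u N); exists N => // n /hN /= h.
rewrite -ball_normE /= distrC rnormE ltcR.
by apply: le_lt_trans h _; lra.
Qed.

Lemma cvg_geometric_steps (u : nat -> H) (C q : R) : 0 <= q < 1 -> 0 <= C ->
  (forall n, rnorm (u n.+1 - u n) <= C * q ^+ n) ->
  exists l : H, u @ \oo --> l /\ forall n, rnorm (u n - l) <= C / (1 - q) * q ^+ n.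
Proof.
move=> /andP[q0 q1] C0 uq; pose K := C / (1 - q).
have K0 : 0 <= K by rewrite divr_ge0 // subr_ge0 ltW.
have KE : C = K * (1 - q) by rewrite divfK // gt_eqF // subr_gt0.
have Kq0 n : 0 <= K * q ^+ n by apply: mulr_ge0 => //; exact: exprn_ge0.
(* The factor 1 - q^k is the exact geometric sum, which lets the induction on k close. *)
have uK n k : rnorm (u (n + k)%N - u n) <= K * q ^+ n * (1 - q ^+ k).
  elim: k => [|k IH]; first by rewrite addn0 subrr rnorm0 expr0 subrr mulr0.
  rewrite addnS (_ : _ - _ = (u (n + k).+1 - u (n + k)%N) + (u (n + k)%N - u n)); last first.
    by rewrite addrA subrK.
  apply: le_trans (ler_rnormD _ _) _; apply: le_trans (lerD (uq _) IH) _.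
  by rewrite {1}KE exprD (exprS q k) le_eqVlt; apply/orP; left; apply/eqP; ring.
have uK' n k : rnorm (u (n + k)%N - u n) <= K * q ^+ n.
  by apply: le_trans (uK n k) _; rewrite ler_piMr // gerBl exprn_ge0.
have qs : (fun n => K * q ^+ n) @ \oo --> 0.
  rewrite -[X in _ --> X](mulr0 K); apply: cvgM; first exact: cvg_cst.
  by apply: cvg_expr; rewrite ger0_norm.
have [|l ul] := rnorm_complete (u := u).
  move=> e e0; move/cvgrPdist_le: qs => /(_ e e0) [N _ hN]; exists N => n Nn.
  have := hN N (leqnn N); rewrite sub0r normrN ger0_norm //.
  by apply: le_trans; rewrite -(subnKC Nn); exact: uK'.
exists l; split=> // n; apply/ler_addgt0Pr => e e0.
move/cvg_rnormP: ul => /(_ e e0) [N hN].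
rewrite (_ : u n - l = (u n - u (n + N)%N) + (u (n + N)%N - l)); last by rewrite addrA subrK.
apply: le_trans (ler_rnormD _ _) _; apply: lerD; first by rewrite rnormBC; exact: uK'.
by apply: hN; rewrite leq_addl.
Qed.

Lemma cvg_rnorm0 (u : nat -> H) l (v : nat -> R) :
  (forall n, rnorm (u n - l) <= v n) -> v @ \oo --> 0 -> u @ \oo --> l.
Proof.
move=> uv v0; apply/cvg_rnormP => e e0.
move/cvgrPdist_le: v0 => /(_ e e0) [N _ hN]; exists N => n /hN /=.
by rewrite sub0r normrN => h; apply: le_trans (uv n) (le_trans (ler_norm _) h).
Qed.

Lemma cvg_unique_seq (u : nat -> H) (l l' : H) : u @ \oo --> l -> u @ \oo --> l' -> l = l'.
Proof. by move=> ul ul'; apply: (cvg_unique _ ul ul'). Qed.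

Section Linear.
Variable A : H -> H.
Hypothesis linA : linear A.

Lemma linear_fun0 : A 0 = 0.
Proof.
have := linA 1 0 0; rewrite !scale1r addr0 => e.
by apply: (addIr (A 0)); rewrite add0r -e.
Qed.

Lemma linear_funD x y : A (x + y) = A x + A y.
Proof. by have := linA 1 x y; rewrite !scale1r. Qed.

Lemma linear_funZ c x : A (c *: x) = c *: A x.
Proof. by have := linA c x 0; rewrite linear_fun0 !addr0. Qed.

Lemma linear_funN x : A (- x) = - A x.
Proof. by rewrite -scaleN1r linear_funZ scaleN1r. Qed.

Lemma linear_funB x y : A (x - y) = A x - A y.
Proof. by rewrite linear_funD linear_funN. Qed.

Lemma linear_iter n : linear (iter n A).
Proof. by move=> c x y; elim: n => //= n ->; rewrite linA. Qed.

End Linear.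

Definition bnd (A : H -> H) (M : R) := forall x, rnorm (A x) <= M * rnorm x.

Lemma bnd_iter A M n : 0 <= M -> bnd A M -> bnd (iter n A) (M ^+ n).
Proof.
move=> M0 bA x; elim: n => [|n IH]; first by rewrite mul1r.
by rewrite iterS; apply: le_trans (bA _) _; rewrite exprS -mulrA ler_wpM2l.
Qed.

Lemma bnd_comp A B M N : 0 <= M -> bnd A M -> bnd B N -> bnd (A \o B) (M * N).
Proof.
move=> M0 bA bB x /=; apply: le_trans (bA _) _.
by rewrite -mulrA ler_wpM2l.
Qed.

Lemma bnd_continuous A M : linear A -> bnd A M -> continuous A.
Proof.
move=> linA bA x; apply/cvgrPdist_le => e e0.
have eE : e = (complex.Re e)%:C by rewrite RRe_real // gtr0_real.
move: e0; rewrite eE ltcR => e0.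
have d0 : 0 < (complex.Re e / (`|M| + 1))%:C by rewrite ltcR divr_gt0 // ltr_wpDl.
near=> y; rewrite -(linear_funB linA) rnormE lecR.
apply: le_trans (bA _) _.
apply: (@le_trans _ _ ((`|M| + 1) * rnorm (x - y))).
  by apply: ler_wpM2r; rewrite ?rnorm_ge0 //; have := ler_norm M; lra.
rewrite mulrC -ler_pdivlMr ?ltr_wpDl //.
by rewrite -lecR -rnormE; near: y; apply: cvgr_dist_le d0; exact: cvg_id.
Unshelve. all: by end_near. Qed.

Lemma bounded_opP A : bounded_op A <-> linear A /\ exists2 M, 0 <= M & bnd A M.
Proof.
split=> [[linA cA]|[linA [M _ bA]]]; last by split=> //; exact: bnd_continuous bA.
split=> //; have : A x @[x --> (0 : H)] --> A 0 := cA 0.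
rewrite (linear_fun0 linA) => /cvgrPdist_le /(_ 1 ltr01) /nbhs_ballP [d /= d0 hd].
have dE : d = (complex.Re d)%:C by rewrite RRe_real // gtr0_real.
move: d0; rewrite dE ltcR => d0; set r := complex.Re d in dE d0.
exists (2 / r) => [|x]; first by rewrite divr_ge0 // ltW.
have [->|x0] := eqVneq x 0; first by rewrite (linear_fun0 linA) rnorm0 mulr0.
have nx : 0 < rnorm x.
  by rewrite lt_def rnorm_ge0 andbT; apply: contra_neq x0; exact: rnorm_eq0.
pose c := r / 2 / rnorm x.
have c0 : 0 < c by rewrite !divr_gt0.
have : `|0 - A (c%:C *: x)| <= 1.
  apply: hd; rewrite -ball_normE /= sub0r normrN rnormE rnormZr dE ltcR.
  by rewrite gtr0_norm // divfK ?gt_eqF //; lra.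
rewrite sub0r normrN rnormE (linear_funZ linA) rnormZr gtr0_norm // lecR.
rewrite mulrC -ler_pdivlMr // div1r /c => h; apply: le_trans h _.
have -> : (r / 2 / rnorm x)^-1 = 2 / r * rnorm x by field; rewrite !gt_eqF.
by [].
Qed.

(* Neumann series, as the fixed points of [x |-> y + Y x]. *)
Lemma one_sub_inverse (Y : H -> H) q : 0 <= q < 1 -> linear Y -> bnd Y q ->
  exists W, [/\ linear W, bnd W (1 - q)^-1, forall x, W (x - Y x) = x &
    forall x, W x - Y (W x) = x].
Proof.
move=> /[dup] q01 /andP[q0 q1] linY bY.
pose w y n := iter n (fun x => y + Y x) 0.
have /choice [W hW] : forall y, exists l : H, w y @ \oo --> l.
  move=> y; have [|||l [wl _]] := @cvg_geometric_steps (w y) (rnorm y) q.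
  - exact: q01.
  - exact: rnorm_ge0.
  - elim=> [|n IH]; first by rewrite /w /= (linear_fun0 linY) addr0 subr0 mulr1.
    rewrite /w !iterS opprD addrACA subrr add0r -(linear_funB linY).
    by apply: le_trans (bY _) _; rewrite exprS mulrCA ler_wpM2l.
  - by exists l.
have WY y : W y - Y (W y) = y.
  apply/eqP; rewrite subr_eq; apply/eqP.
  have h1 : (fun n => w y n.+1) @ \oo --> W y by rewrite (cvg_shiftS (w y)); exact: hW.
  have h2 : (fun n => w y n.+1) @ \oo --> y + Y (W y).
    rewrite /w /=; apply: cvgD; first exact: cvg_cst.
    by apply: (cvg_comp _ _ (hW y)); exact: (bnd_continuous linY bY).
  exact: cvg_unique_seq h1 h2.
(* Injectivity of 1 - Y turns the right inverse W into a two-sided one and gives its linearity. *)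
have inj x : x - Y x = 0 -> x = 0.
  move/eqP; rewrite subr_eq0 => /eqP xY; apply: rnorm_eq0; apply/eqP.
  rewrite eq_le rnorm_ge0 andbT; have := bY x; rewrite -xY.
  by rewrite -subr_le0 -{1}[rnorm x]mul1r -mulrBl pmulr_rle0 // subr_gt0.
have inj2 x y : x - Y x = y - Y y -> x = y.
  move=> h; apply/eqP; rewrite -subr_eq0; apply/eqP; apply: inj.
  rewrite (linear_funB linY) (_ : _ - _ = (x - Y x) - (y - Y y)); last first.
    by rewrite !opprD addrACA.
  by rewrite h subrr.
exists W; split=> //.
- move=> c x y; apply: inj2; rewrite WY linY opprD addrACA -scalerBr !WY //.
- move=> x; rewrite ler_pdivlMl ?subr_gt0 // mulrBl mul1r.
  rewrite lerBlDr {1}(_ : W x = x + Y (W x)); last by rewrite -{2}(WY x) subrK.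
  by apply: le_trans (ler_rnormD _ _) _; rewrite lerD2l.
- by move=> x; apply: inj2; rewrite WY.
Qed.

End HilbertSpace.

(** * Real inner product, Riesz representation and adjoints *)

Section InnerProduct.
Variables (R : realType) (H : completeNormedModType R[i]).
Variable dot : {dot H for Num.conj}.
Hypothesis hdot : inner_product_norm dot.

Definition rdot (x y : H) : R := complex.Re (dot x y).

Lemma dotC x y : dot x y = (dot y x)^*.
Proof. by rewrite hermC expr0 mul1r. Qed.

Lemma rdotC x y : rdot x y = rdot y x.
Proof. by rewrite /rdot dotC; case: (dot y x). Qed.

Lemma rdotDl x y z : rdot (x + y) z = rdot x z + rdot y z.
Proof. by rewrite /rdot linearDl /= ReD. Qed.

Lemma rdotNl x z : rdot (- x) z = - rdot x z.
Proof. by rewrite /rdot linearNl /= ReN. Qed.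

Lemma rdotBl x y z : rdot (x - y) z = rdot x z - rdot y z.
Proof. by rewrite rdotDl rdotNl. Qed.

Lemma rdotZl (c : R) x z : rdot (c%:C *: x) z = c * rdot x z.
Proof. by rewrite /rdot linearZl_LR /= Re_rM. Qed.

Lemma rdot0l z : rdot 0 z = 0.
Proof. by rewrite /rdot linear0l. Qed.

Lemma rdotDr x y z : rdot z (x + y) = rdot z x + rdot z y.
Proof. by rewrite !(rdotC z) rdotDl. Qed.

Lemma rdotBr x y z : rdot z (x - y) = rdot z x - rdot z y.
Proof. by rewrite !(rdotC z) rdotBl. Qed.

Lemma rdotZr (c : R) x z : rdot z (c%:C *: x) = c * rdot z x.
Proof. by rewrite !(rdotC z) rdotZl. Qed.

Lemma rdot_suml n (F : nat -> H) y :
  rdot (\sum_(k < n) F k) y = \sum_(k < n) rdot (F k) y.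
Proof.
by elim: n => [|n IH]; rewrite ?big_ord0 ?rdot0l // !big_ord_recr /= rdotDl IH.
Qed.

Lemma rdotxx x : rdot x x = rnorm x ^+ 2.
Proof. by rewrite /rdot -hdot rnormE -rmorphXn. Qed.

Lemma rnormD_sqr x y : rnorm (x + y) ^+ 2 = rnorm x ^+ 2 + 2 * rdot x y + rnorm y ^+ 2.
Proof. by rewrite -!rdotxx rdotDl !rdotDr (rdotC y x); ring. Qed.

Lemma rnormB_sqr x y : rnorm (x - y) ^+ 2 = rnorm x ^+ 2 - 2 * rdot x y + rnorm y ^+ 2.
Proof. by rewrite -!rdotxx rdotBl !rdotBr (rdotC y x); ring. Qed.

(** Weighted AM-GM, from |l x + y|^2 >= 0 and |l x - y|^2 >= 0. The weight is |y| / |x| for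
    Cauchy-Schwarz, and the bound [K] for differences of hereditary sums. *)
Lemma rdot_bound x y (l : R) : 0 < l ->
  2 * `|rdot x y| <= l * rnorm x ^+ 2 + l^-1 * rnorm y ^+ 2.
Proof.
move=> l0; have ll : l * l^-1 = 1 by rewrite mulfV // gt_eqF.
have li0 : 0 < l^-1 by rewrite invr_gt0.
have h1 := sqr_ge0 (rnorm (l%:C *: x + y)).
have h2 := sqr_ge0 (rnorm (l%:C *: x - y)).
move: h1 h2; rewrite rnormD_sqr rnormB_sqr rnormZr rdotZl gtr0_norm // exprMn.
have [_|_] := ger0P (rdot x y) => h1 h2.
  have := mulr_ge0 (ltW li0) h2.
  have -> : l^-1 * (l ^+ 2 * rnorm x ^+ 2 - 2 * (l * rdot x y) + rnorm y ^+ 2) =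
    (l * l^-1) * l * rnorm x ^+ 2 - 2 * (l * l^-1) * rdot x y + l^-1 * rnorm y ^+ 2 by ring.
  by rewrite ll; lra.
have := mulr_ge0 (ltW li0) h1.
have -> : l^-1 * (l ^+ 2 * rnorm x ^+ 2 + 2 * (l * rdot x y) + rnorm y ^+ 2) =
    (l * l^-1) * l * rnorm x ^+ 2 + 2 * (l * l^-1) * rdot x y + l^-1 * rnorm y ^+ 2 by ring.
by rewrite ll; lra.
Qed.

Lemma rdot_le x y : `|rdot x y| <= rnorm x * rnorm y.
Proof.
have [x0|x0] := eqVneq (rnorm x) 0.
  by rewrite (rnorm_eq0 x0) rdot0l normr0 mulr_ge0 ?rnorm_ge0.
have [y0|y0] := eqVneq (rnorm y) 0.
  by rewrite (rnorm_eq0 y0) rdotC rdot0l normr0 mulr_ge0 ?rnorm_ge0.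
have xp : 0 < rnorm x by rewrite lt_def x0 rnorm_ge0.
have yp : 0 < rnorm y by rewrite lt_def y0 rnorm_ge0.
have := rdot_bound x y (divr_gt0 yp xp).
have -> : rnorm y / rnorm x * rnorm x ^+ 2 + (rnorm y / rnorm x)^-1 * rnorm y ^+ 2 =
  2 * (rnorm x * rnorm y) by field; apply/andP.
by rewrite ler_pM2l.
Qed.

Lemma rdot_ext x y : (forall z, rdot x z = rdot y z) -> x = y.
Proof.
move=> h; apply/eqP; rewrite -subr_eq0; apply/eqP/rnorm_eq0/eqP.
by rewrite -sqrf_eq0 -rdotxx rdotBl h subrr.
Qed.

(** The imaginary part is recovered from Im <u, v> = - Re <i u, v> and the linearity of [A], so
    identities need only be proved for real parts. *)
Lemma dot_of_rdot (A B : H -> H) : linear A ->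
  (forall x y, rdot (A x) y = rdot x (B y)) -> forall x y, dot (A x) y = dot x (B y).
Proof.
move=> linA AB x y.
have ImE u v : complex.Im (dot u v) = - rdot ('i%C *: u) v.
  by rewrite /rdot linearZl_LR /=; case: (dot u v) => p q /=; ring.
apply/eqP; rewrite eq_complex; apply/andP; split; apply/eqP; first exact: AB.
by rewrite !ImE -AB (linear_funZ linA).
Qed.

Lemma cvg_rdot (u : nat -> H) l y : u @ \oo --> l -> (fun n => rdot (u n) y) @ \oo --> rdot l y.
Proof.
move=> ul; apply/cvgrPdist_le => e e0.
have d0 : 0 < e / (rnorm y + 1) by rewrite divr_gt0 // ltr_wpDl // rnorm_ge0.
move/cvg_rnormP: ul => /(_ _ d0) [N hN]; exists N => // n /hN /= h.
rewrite -rdotBl; apply: le_trans (rdot_le _ _) _; rewrite rnormBC.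
have y0 := rnorm_ge0 y.
apply: le_trans (ler_wpM2r y0 h) _; rewrite mulrAC ler_pdivrMr; last lra.
by apply: ler_wpM2l; [exact: ltW|lra].
Qed.

(* The vector representing [g] minimises |v|^2 - 2 g v. *)
Lemma riesz (g : H -> R) K : (forall x y, g (x + y) = g x + g y) ->
  (forall (c : R) x, g (c%:C *: x) = c * g x) -> (forall x, `|g x| <= K * rnorm x) ->
  exists w, forall x, rdot w x = g x.
Proof.
move=> gD gZ gK; pose J v := rnorm v ^+ 2 - 2 * g v.
have Jge v : - K ^+ 2 <= J v.
  have h1 := gK v; have h2 := ler_norm (g v); have h3 := sqr_ge0 (rnorm v - K).
  by rewrite /J; nra.
have hasJ : has_inf (range J).
  split; first by exists (J 0); exists 0.
  by exists (- K ^+ 2) => _ [v _ <-].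
pose m := inf (range J).
have mJ v : m <= J v by apply: ge_inf; [case: hasJ | exists v].
have /choice [v vm] n : exists v, J v <= m + n.+1%:R^-1.
  have n0 : 0 < n.+1%:R^-1 :> R by rewrite invr_gt0 ltr0n.
  have [_ [v _ <-] h] := inf_adherent n0 hasJ.
  by exists v; exact: ltW.
(* Parallelogram law. As J is at least m at the midpoint, |x - y|^2 <= 2 (J x - m) + 2 (J y - m), so
   a minimising sequence is Cauchy. *)
have JM x y : rnorm (x - y) ^+ 2 = 2 * J x + 2 * J y - 4 * J ((2^-1)%:C *: (x + y)).
  by rewrite rnormB_sqr /J rnormZr gZ gD ger0_norm ?invr_ge0 // exprMn rnormD_sqr; lra.
have [w vw] : exists l : H, v @ \oo --> l.
  apply: rnorm_complete => e e0.
  have e2 : 0 < e ^+ 2 / 4 by rewrite divr_gt0 // exprn_gt0.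
  have [N] : exists N, (e ^+ 2 / 4)^-1 < N%:R.
    by exists (Num.bound (e ^+ 2 / 4)^-1); apply: archi_boundP; rewrite invr_ge0 ltW.
  move=> hN; exists N => n Nn.
  rewrite -(ler_pXn2r (ltn0Sn 1)) ?nnegrE ?rnorm_ge0 ?(ltW e0) // JM.
  have := vm n; have := vm N; have := mJ ((2^-1)%:C *: (v n + v N)).
  have dN : N.+1%:R^-1 <= e ^+ 2 / 4.
    rewrite -[leRHS]invrK lef_pV2 ?posrE ?invr_gt0 ?ltr0n //.
    by apply: le_trans (ltW hN) _; rewrite ler_nat.
  have dn : n.+1%:R^-1 <= N.+1%:R^-1 :> R by rewrite lef_pV2 ?posrE ?ltr0n // ler_nat ltnS.
  move: (J (v n)) (J (v N)) (J _) (n.+1%:R^-1) (N.+1%:R^-1) dN dn => a b c i j.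
  by lra.
exists w => x.
(* First variation: J (v_n + t x) >= m >= J v_n - 1/(n+1), with n tending to infinity. *)
have ineq t : 0 <= 2 * t * (rdot w x - g x) + t ^+ 2 * rnorm x ^+ 2.
  have lim1 : (fun n => 2 * t * (rdot (v n) x - g x) + t ^+ 2 * rnorm x ^+ 2 + n.+1%:R^-1) @ \oo -->
      2 * t * (rdot w x - g x) + t ^+ 2 * rnorm x ^+ 2 + 0.
    apply: cvgD; last exact: cvg_harmonic.
    apply: cvgD; last exact: cvg_cst.
    apply: cvgM; first exact: cvg_cst.
    by apply: cvgB; [exact: cvg_rdot | exact: cvg_cst].
  rewrite addr0 in lim1; apply: (cvgr_to_ge lim1); exists 0%N => // n _ /=.
  have := vm n; have := mJ (v n + t%:C *: x).
  rewrite /J rnormD_sqr rdotZr rnormZr exprMn real_normK ?num_real // gD gZ.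
  by move: (n.+1%:R^-1) (rnorm (v n) ^+ 2) (rnorm x ^+ 2) => i p q; lra.
set d := rdot w x - g x in ineq.
suff d0 : d = 0 by apply/eqP; rewrite -subr_eq0 -/d d0.
have [x0|x0] := eqVneq (rnorm x) 0.
  by have := ineq (- d); rewrite x0; have := sqr_ge0 d; nra.
have xp : 0 < rnorm x ^+ 2 by rewrite exprn_gt0 // lt_def x0 rnorm_ge0.
(* The value of t that minimises the quadratic, which there equals - d^2 / |x|^2. *)
have := ineq (- d / rnorm x ^+ 2).
have -> : 2 * (- d / rnorm x ^+ 2) * d + (- d / rnorm x ^+ 2) ^+ 2 * rnorm x ^+ 2 =
  - (d ^+ 2 / rnorm x ^+ 2) by field.
rewrite oppr_ge0 pmulr_lle0 ?invr_gt0 // => h.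
by apply/eqP; rewrite -sqrf_eq0 eq_le h sqr_ge0.
Qed.

(** [op_adjoint] is chosen by [get], so its defining identity rests on existence, obtained by
    representing x |-> Re <T x, y>. *)
Lemma op_adjointP (T : H -> H) : bounded_op T ->
  forall x y, dot (T x) y = dot x (op_adjoint dot T y).
Proof.
move=> /bounded_opP [linT [M M0 bT]].
have /choice [S hS] : forall y, exists w, forall x, rdot w x = rdot (T x) y.
  move=> y; apply: (@riesz _ (M * rnorm y)).
  - by move=> x z; rewrite (linear_funD linT) rdotDl.
  - by move=> c x; rewrite (linear_funZ linT) rdotZl.
  - move=> x; apply: le_trans (rdot_le _ _) _.
    by rewrite mulrAC ler_wpM2r ?rnorm_ge0.
have : exists S : H -> H, forall x y, dot (T x) y = dot x (S y).
  by exists S; apply: dot_of_rdot => // x y; rewrite -hS rdotC.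
by move/(@getPex _ [set S | forall x y, dot (T x) y = dot x (S y)]).
Qed.

Lemma op_adjoint_linear T : bounded_op T -> linear (op_adjoint dot T).
Proof.
move=> bT c x y; apply: rdot_ext => z; rewrite !(rdotC _ z) /rdot.
by rewrite -(op_adjointP bT) !linearDr !linearZr_LR /= !(op_adjointP bT).
Qed.

Lemma rdot_iter_adjoint T n x y : bounded_op T ->
  rdot (iter n (op_adjoint dot T) (iter n T x)) y = rdot (iter n T x) (iter n T y).
Proof.
move=> bT; suff h z : rdot (iter n (op_adjoint dot T) z) y = rdot z (iter n T y) by [].
elim: n y => // n IH y; rewrite iterS iterSr rdotC /rdot -(op_adjointP bT) -/(rdot _ _).
by rewrite rdotC IH.
Qed.

Lemma bnd_op_adjoint T M : bounded_op T -> bnd T M -> bnd (op_adjoint dot T) M.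
Proof.
move=> bT TM y; set z := op_adjoint dot T y.
have [z0|z0] := eqVneq (rnorm z) 0.
  rewrite z0; apply: le_trans (TM _); exact: rnorm_ge0.
have zp : 0 < rnorm z by rewrite lt_def z0 rnorm_ge0.
rewrite -(ler_pM2l zp) -expr2 -rdotxx {2}/z /rdot -(op_adjointP bT) -/(rdot _ _).
apply: le_trans (ler_norm _) (le_trans (rdot_le _ _) _).
by apply: le_trans (ler_wpM2r (rnorm_ge0 y) (TM z)) _; rewrite mulrCA mulrA.
Qed.

End InnerProduct.

(** * Quadratic forms of hereditary sums *)

Section HereditarySums.
Variables (R : realType) (H : completeNormedModType R[i]).
Variable T : H -> H.
Implicit Types (f g : nat -> R) (K L : R) (x : H).

(** The scalar substitute for membership in A_T: the form of sum_n |f_n| T^*n T^n is bounded by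
    K. *)
Definition hbnd f K := forall x N,
  \sum_(n < N) `|f n| * rnorm (iter n T x) ^+ 2 <= K * rnorm x ^+ 2.

(** The form <f(T^*, T) x, x>; the limit exists once some [hbnd T f K] holds. *)
Definition hform f x : R := limn (fun N => \sum_(n < N) f n * rnorm (iter n T x) ^+ 2).

(** For fixed k, the sum over m is a partial sum for [g] at the vector T^k x, hence at most L |T^k
    x|^2; the bound for [f] then applies. *)
Lemma hbnd_cprod f g K L : 0 <= L -> hbnd f K -> hbnd g L -> hbnd (cprod f g) (K * L).
Proof.
move=> L0 fK gL x N; pose u n := rnorm (iter n T x) ^+ 2.
apply: (@le_trans _ _ (\sum_(n < N) cprod (fun k => `|f k|) (fun k => `|g k|) n * u n)).
  apply: ler_sum => n _; apply: ler_wpM2r; first exact: sqr_ge0.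
  by apply: le_trans (ler_norm_sum _ _ _) _; apply: ler_sum => k _; rewrite normrM.
rewrite sum_cprod.
apply: (@le_trans _ _ (\sum_(k < N) `|f k| * (L * u k))).
  apply: ler_sum => k _; apply: le_trans (ler_wpM2l (normr_ge0 _) (gL (iter k T x) (N - k)%N)).
  rewrite mulr_sumr; apply: ler_sum => m _; rewrite [leRHS]mulrA.
  by rewrite /u addnC iterD.
under eq_bigr do rewrite mulrCA.
by rewrite -mulr_sumr (mulrC K) -mulrA ler_wpM2l //; exact: fK.
Qed.

Lemma hform_cvg f K x : hbnd f K ->
  (fun N => \sum_(n < N) f n * rnorm (iter n T x) ^+ 2) @ \oo --> hform f x.
Proof.
move=> fK; pose v n := f n * rnorm (iter n T x) ^+ 2.
have sE (w : nat -> R) : series w = fun N => \sum_(n < N) w n.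
  by apply/funext => N; rewrite /series /= big_mkord.
suff : cvgn (series v) by rewrite sE.
apply: normed_cvg; rewrite -[X in cvgn X]/(series (fun n => `|v n|)) sE.
apply: nondecreasing_is_cvgn.
  by move=> m n mn; apply: (@ler_sum_prefix _ (fun k => `|v k|)).
exists (K * rnorm x ^+ 2) => _ [N _ <-]; apply: le_trans (fK x N).
by apply: ler_sum => n _; rewrite normrM (ger0_norm (sqr_ge0 _)).
Qed.

(** The identity (f g)(T^*, T) = sum_k f_k T^*k g(T^*, T) T^k, read on quadratic forms. *)
Lemma hform_cprod f g K L x : 0 <= L -> hbnd f K -> hbnd g L ->
  (fun N => \sum_(k < N) f k * hform g (iter k T x)) @ \oo --> hform (cprod f g) x.
Proof.
move=> L0 fK gL; pose u n := rnorm (iter n T x) ^+ 2.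
pose F k m := f k * g m * u (k + m)%N.
have FE k m : F k m = f k * (g m * rnorm (iter m T (iter k T x)) ^+ 2).
  by rewrite /F /u addnC iterD mulrA.
have h : (fun N => \sum_(k < N) f k * hform g (iter k T x) -
    \sum_(k < N) \sum_(m < N - k) F k m) @ \oo --> (0 : R).
  apply: (@cvg_sum_triangle R F (fun k => f k * hform g (iter k T x)) (K * L * rnorm x ^+ 2)).
  move=> N; apply: (@le_trans _ _ (\sum_(k < N) `|f k| * (L * u k))).
    apply: ler_sum => k _; apply: le_trans (ler_wpM2l (normr_ge0 _) (gL (iter k T x) N)).
    rewrite mulr_sumr; apply: ler_sum => m _.
    by rewrite FE normrM normrM (ger0_norm (sqr_ge0 _)).
  under eq_bigr do rewrite mulrCA.
  by rewrite -mulr_sumr (mulrC K) -mulrA ler_wpM2l //; exact: fK.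
  move=> k; rewrite (_ : (fun M => _) =
      fun M => f k * \sum_(m < M) g m * rnorm (iter m T (iter k T x)) ^+ 2); last first.
    by apply/funext => M; rewrite mulr_sumr; apply: eq_bigr => m _; rewrite FE.
  by apply: cvgM; [exact: cvg_cst | exact: hform_cvg gL].
rewrite -[hform _ x]add0r (_ : (fun N => _) = fun N =>
    (\sum_(k < N) f k * hform g (iter k T x) - \sum_(k < N) \sum_(m < N - k) F k m) +
    \sum_(n < N) cprod f g n * u n); last first.
  by apply/funext => N; rewrite sum_cprod subrK.
exact: (cvgD h (hform_cvg (hbnd_cprod L0 fK gL))).
Qed.

End HereditarySums.

(** * Strong convergence from scalar bounds *)

Section StrongConvergence.
Variables (R : realType) (H : completeNormedModType R[i]).
Variable dot : {dot H for Num.conj}.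
Hypothesis hdot : inner_product_norm dot.
Variable T : H -> H.
Hypothesis bT : bounded_op T.
Implicit Types (f : nat -> R) (K : R) (x : H).

Lemma hereditary_sumE (c : nat -> R[i]) f x N : (forall n, c n = (f n)%:C) ->
  hereditary_sum dot c T N x =
  \sum_(n < N) (f n)%:C *: iter n (op_adjoint dot T) (iter n T x).
Proof.
move=> cE; rewrite /hereditary_sum /series /= big_mkord.
by apply: eq_bigr => n _; rewrite cE.
Qed.

Lemma rdot_hereditary_sum (c : nat -> R[i]) f x y N : (forall n, c n = (f n)%:C) ->
  rdot dot (hereditary_sum dot c T N x) y =
  \sum_(n < N) f n * rdot dot (iter n T x) (iter n T y).
Proof.
move=> cE; rewrite (hereditary_sumE _ _ cE).
rewrite (rdot_suml _ _ (fun n => (f n)%:C *: iter n (op_adjoint dot T) (iter n T x))).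
by apply: eq_bigr => n _; rewrite rdotZl rdot_iter_adjoint.
Qed.

Lemma hereditary_sum_bounded (c : nat -> R[i]) N : bounded_op (hereditary_sum dot c T N).
Proof.
have linA := op_adjoint_linear hdot bT.
have [linT [M M0 bM]] := (bounded_opP T).1 bT.
have bA := bnd_op_adjoint hdot bT bM.
apply/bounded_opP; split.
  move=> a x y; rewrite /hereditary_sum /series /= !big_mkord scaler_sumr -big_split.
  apply: eq_bigr => n _ /=; rewrite (linear_iter linT) (linear_iter linA).
  by rewrite scalerDr !scalerA mulrC.
exists (\sum_(n < N) complex.Re `|c n| * (M ^+ n * M ^+ n)).
  by apply: sumr_ge0 => n _; rewrite !mulr_ge0 ?exprn_ge0 // Re_normc_ge0.
move=> x; rewrite /hereditary_sum /series /= big_mkord.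
elim: N => [|N IH]; first by rewrite !big_ord0 rnorm0 mul0r.
rewrite !big_ord_recr /= mulrDl; apply: le_trans (ler_rnormD _ _) (lerD IH _).
rewrite rnormZ -!mulrA; apply: ler_wpM2l; first exact: Re_normc_ge0.
rewrite -/(iter N _ _) -/(iter N T x); apply: le_trans (bnd_iter _ M0 bA _) _.
by rewrite ler_wpM2l ?exprn_ge0 //; exact: bnd_iter.
Qed.

(* Estimating <v, y> termwise by AM-GM for [y = v], the difference of two partial sums. *)
Lemma hereditary_sum_sub (c : nat -> R[i]) f K x m n : (forall n, c n = (f n)%:C) ->
  0 < K -> hbnd T f K -> (m <= n)%N ->
  rnorm (hereditary_sum dot c T n x - hereditary_sum dot c T m x) ^+ 2 <=
  K * \sum_(m <= k < n) `|f k| * rnorm (iter k T x) ^+ 2.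
Proof.
move=> cE K0 fK mn; set v := _ - _.
pose t y := \sum_(m <= k < n) `|f k| * rnorm (iter k T y) ^+ 2.
have tle y : t y <= K * rnorm y ^+ 2.
  apply: le_trans (fK y n).
  rewrite (sum_prefix_split (fun k => `|f k| * rnorm (iter k T y) ^+ 2) mn) lerDr.
  by apply: sumr_ge0 => k _; rewrite mulr_ge0 // sqr_ge0.
have vE : rnorm v ^+ 2 = \sum_(m <= k < n) f k * rdot dot (iter k T x) (iter k T v).
  rewrite -(rdotxx hdot) {1}/v rdotBl !(rdot_hereditary_sum _ _ _ cE).
  rewrite (sum_prefix_split (fun k => f k * rdot dot (iter k T x) (iter k T v)) mn).
  by rewrite addrAC subrr add0r.
have h : 2 * rnorm v ^+ 2 <= K * t x + K^-1 * t v.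
  rewrite vE !mulr_sumr -big_split; apply: ler_sum => k _ /=.
  have := rdot_bound hdot (iter k T x) (iter k T v) K0.
  move=> /(ler_wpM2l (normr_ge0 (f k))) h.
  apply: le_trans (_ : _ <= 2 * (`|f k| * `|rdot dot (iter k T x) (iter k T v)|)) _.
    by rewrite ler_pM2l // -normrM ler_norm.
  by move: (K^-1) h => Ki h; lra.
(* The bound for [f] at [v] itself lets half of 2 |v|^2 absorb this term. *)
have : K^-1 * t v <= rnorm v ^+ 2.
  by rewrite ler_pdivrMl //; exact: tle.
by rewrite -/(t x); lra.
Qed.

(** Increments of the partial sums are controlled by tails of a convergent scalar series, whatever
    the signs of the coefficients. The last clause gives the form of the limit, from which its
    symmetry is deduced. *)
Lemma hereditary_sum_sot (c : nat -> R[i]) f K : (forall n, c n = (f n)%:C) ->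
  0 < K -> hbnd T f K ->
  exists A, [/\ linear A, bnd A K,
    forall x, (fun N => hereditary_sum dot c T N x) @ \oo --> A x &
    forall x y, (fun N => \sum_(n < N) f n * rdot dot (iter n T x) (iter n T y)) @ \oo -->
      rdot dot (A x) y].
Proof.
move=> cE K0 fK.
have /choice [A hA] : forall x, exists l : H, (fun N => hereditary_sum dot c T N x) @ \oo --> l.
  move=> x; apply: rnorm_complete => e e0.
  have fK' : hbnd T (fun n => `|f n|) K.
    by move=> y N; under eq_bigr do rewrite normr_id; exact: fK.
  have e2 : 0 < e ^+ 2 / K / 2 by rewrite !divr_gt0 // exprn_gt0.
  have /cvgrPdist_le /(_ _ e2) [N _ hN] := hform_cvg (x := x) fK'.
  exists N => n Nn; rewrite -(ler_pXn2r (ltn0Sn 1)) ?nnegrE ?rnorm_ge0 ?(ltW e0) //.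
  apply: le_trans (hereditary_sum_sub x cE K0 fK Nn) _.
  rewrite mulrC -ler_pdivlMr //.
  have := hN _ Nn; have := hN _ (leqnn N); rewrite /= !ler_norml => /andP[h1 h2] /andP[h3 h4].
  have := sum_prefix_split (fun k => `|f k| * rnorm (iter k T x) ^+ 2) Nn.
  by move: h1 h2 h3 h4; lra.
exists A; split=> //.
- move=> a x y; apply: (cvg_unique_seq (hA _)).
  under eq_cvg do rewrite (hereditary_sum_bounded c _).1.
  by apply: cvgD; [apply: cvgZr|]; exact: hA.
- move=> x; apply/ler_addgt0Pr => e e0.
  have /cvg_rnormP /(_ e e0) [N hN] := hA x.
  rewrite (_ : A x = - (hereditary_sum dot c T N x - A x) + hereditary_sum dot c T N x); last first.
    by rewrite opprB subrK.
  apply: le_trans (ler_rnormD _ _) _; rewrite addrC rnormN; apply: lerD; last exact: hN.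
  rewrite -(ler_pXn2r (ltn0Sn 1)) ?nnegrE ?mulr_ge0 ?rnorm_ge0 ?(ltW K0) //.
  have := hereditary_sum_sub x cE K0 fK (leq0n N).
  rewrite {2}/hereditary_sum /series /= big_geq // subr0 => h; apply: le_trans h _.
  rewrite exprMn expr2 -mulrA ler_pM2l //; apply: le_trans (fK x N).
  by rewrite big_mkord.
- move=> x y; under eq_cvg do rewrite -(rdot_hereditary_sum _ _ _ cE).
  exact: (cvg_rdot hdot).
Qed.

End StrongConvergence.

(** * Square roots of positive operators *)

Section OperatorSquareRoot.
Variables (R : realType) (H : completeNormedModType R[i]).
Variable dot : {dot H for Num.conj}.
Hypothesis hdot : inner_product_norm dot.

(** Positivity of the form at x - C x / q, with <C C x, C x> <= q |C x|^2, gives |C x|^2 / q <= <C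
    x, x> <= q |x|^2. *)
Lemma bnd_of_form (C : H -> H) (q : R) : linear C -> 0 < q ->
  (forall x y, rdot dot (C x) y = rdot dot x (C y)) ->
  (forall x, 0 <= rdot dot (C x) x <= q * rnorm x ^+ 2) -> bnd C q.
Proof.
move=> linC q0 sC fC x.
have /andP[h _] := fC (x - (q^-1)%:C *: C x).
have /andP[_ h1] := fC x; have /andP[_ h2] := fC (C x).
move: h; rewrite (linear_funB linC) (linear_funZ linC) rdotBl !rdotBr !rdotZr !rdotZl.
rewrite (sC (C x) x) (rdotxx hdot) => h.
rewrite -(ler_pXn2r (ltn0Sn 1)) ?nnegrE ?mulr_ge0 ?rnorm_ge0 ?(ltW q0) //.
have qi0 : 0 < q^-1 by rewrite invr_gt0.
have h3 : q^-1 * (q^-1 * rdot dot (C (C x)) (C x)) <= q^-1 * rnorm (C x) ^+ 2.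
  by rewrite ler_pM2l // ler_pdivrMl.
have h4 : q^-1 * rnorm (C x) ^+ 2 <= q * rnorm x ^+ 2 by lra.
by move: h4; rewrite ler_pdivrMl // exprMn expr2 mulrA.
Qed.

(* With [1 - Y] as the unknown square root of [1 - C], the equation becomes
   [Y = (C + Y^2) / 2], whose iteration contracts the ball of radius [q]. *)
Lemma one_sub_sqrt (C : H -> H) (q : R) : 0 < q < 1 -> linear C ->
  (forall x y, rdot dot (C x) y = rdot dot x (C y)) -> bnd C q ->
  exists Y, [/\ linear Y, bnd Y q, forall x y, rdot dot (Y x) y = rdot dot x (Y y) &
    forall x, 2%:C *: Y x = C x + Y (Y x)].
Proof.
move=> /andP[q0 q1] linC sC bC.
pose Y n := iter n (fun (Y : H -> H) x => (2^-1)%:C *: (C x + Y (Y x))) (fun=> 0).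
have YS n x : Y n.+1 x = (2^-1)%:C *: (C x + Y n (Y n x)) by [].
have linY n : linear (Y n).
  elim: n => [|n IH] c x y; first by rewrite /Y /= scaler0 addr0.
  rewrite !YS linC !IH scalerA [c * _]mulrC -scalerA -scalerDr.
  by congr (_ *: _); rewrite scalerDr addrACA.
have bY n : bnd (Y n) q.
  elim: n => [|n IH] x; first by rewrite /Y /= rnorm0 mulr_ge0 ?rnorm_ge0 // ltW.
  rewrite YS rnormZr ger0_norm ?invr_ge0 //.
  have h1 := ler_rnormD (C x) (Y n (Y n x)); have h2 := bC x.
  have h3 := IH (Y n x); have h4 := IH x; have h5 := rnorm_ge0 x.
  have h6 : q * rnorm (Y n x) <= rnorm (Y n x) by rewrite ler_piMl ?rnorm_ge0 // ltW.
  by lra.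
have sY n x y : rdot dot (Y n x) y = rdot dot x (Y n y).
  elim: n x y => [|n IH] x y; first by rewrite /Y /= rdot0l rdotC rdot0l.
  rewrite !YS rdotZl rdotZr rdotDl rdotDr sC.
  by rewrite !IH.
have dY n x : rnorm (Y n.+1 x - Y n x) <= q * rnorm x * q ^+ n.
  elim: n x => [|n IH] x.
    rewrite (YS 0%N) /Y /= addr0 subr0 mulr1 rnormZr ger0_norm ?invr_ge0 //.
    by have := bC x; have := rnorm_ge0 (C x); lra.
  rewrite (YS n.+1) (YS n) -scalerBr -(YS n) rnormZr ger0_norm ?invr_ge0 //.
  rewrite opprD addrACA subrr add0r.
  (* A difference of squares: each of the two terms gains a factor q, and the factor 1/2 in the
     iteration compensates for there being two. *)
  rewrite (_ : _ - _ = Y n.+1 (Y n.+1 x - Y n x) + (Y n.+1 (Y n x) - Y n (Y n x))); last first.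
    by rewrite (linear_funB (linY n.+1)) addrA subrK.
  have h1 := ler_rnormD (Y n.+1 (Y n.+1 x - Y n x)) (Y n.+1 (Y n x) - Y n (Y n x)).
  have h2 := bY n.+1 (Y n.+1 x - Y n x); have h3 := IH (Y n x).
  have h4 := ler_wpM2l (ltW q0) (IH x); have h5 := bY n x.
  have h6 : q * rnorm (Y n x) * q ^+ n <= q * (q * rnorm x) * q ^+ n.
    by rewrite ler_wpM2r ?exprn_ge0 ?(ltW q0) // ler_pM2l.
  by rewrite exprS; lra.
have /choice [Z hZ] : forall x, exists l : H, (fun n => Y n x) @ \oo --> l /\
    forall n, rnorm (Y n x - l) <= q * rnorm x / (1 - q) * q ^+ n.
  move=> x; apply: (@cvg_geometric_steps _ _ (fun n => Y n x) (q * rnorm x) q) => [|| n]; last exact: dY.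
    by rewrite q1 ltW.
  by rewrite mulr_ge0 ?rnorm_ge0 // ltW.
have ZY x : (fun n => Y n x) @ \oo --> Z x by have [] := hZ x.
have linZ : linear Z.
  move=> c x y; apply: cvg_unique_seq (ZY _) _.
  under eq_cvg do rewrite linY.
  by apply: cvgD; [apply: cvgZr|]; exact: ZY.
have bZ : bnd Z q.
  move=> x; apply/ler_addgt0Pr => e e0; have /cvg_rnormP /(_ e e0) [N hN] := ZY x.
  rewrite (_ : Z x = Y N x - (Y N x - Z x)); last by rewrite opprB addrC subrK.
  by apply: le_trans (ler_rnormB _ _) _; apply: lerD; [exact: bY | exact: hN].
exists Z; split=> //.
- move=> x y; have h1 := cvg_rdot hdot (y := y) (ZY x).
  have h2 := cvg_rdot hdot (y := x) (ZY y).
  rewrite (_ : (fun n => _) = fun n => rdot dot (Y n x) y) in h2; last first.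
    by apply/funext => n; rewrite sY rdotC.
  by rewrite (rdotC dot x); exact: (cvg_unique _ h1 h2).
- move=> x.
  have YYx : (fun n => Y n (Y n x)) @ \oo --> Z (Z x).
    apply: (@cvg_rnorm0 _ _ _ _ (fun n => (q * (q * rnorm x / (1 - q)) +
      q * rnorm (Z x) / (1 - q)) * q ^+ n)).
      move=> n; rewrite (_ : _ - _ = Y n (Y n x - Z x) + (Y n (Z x) - Z (Z x))); last first.
        by rewrite (linear_funB (linY n)) addrA subrK.
      apply: le_trans (ler_rnormD _ _) _; rewrite mulrDl; apply: lerD.
        by apply: le_trans (bY _ _) _; rewrite -mulrA ler_pM2l //; have [_] := hZ x; exact.
      by have [_] := hZ (Z x); exact.
    rewrite -[X in _ --> X](mulr0 (q * (q * rnorm x / (1 - q)) + q * rnorm (Z x) / (1 - q))).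
    by apply: cvgM; [exact: cvg_cst | apply: cvg_expr; rewrite gtr0_norm].
  have ZS : (fun n => 2%:C *: Y n.+1 x) @ \oo --> 2%:C *: Z x.
    by apply: cvgZr; rewrite (cvg_shiftS (fun n => Y n x)).
  apply: cvg_unique_seq ZS _.
  rewrite (_ : (fun n => _) = fun n => C x + Y n (Y n x)); last first.
    apply/funext => n; rewrite YS scalerA -rmorphM /= mulfV ?scale1r //.
  by apply: cvgD; [exact: cvg_cst|].
Qed.

Lemma positive_op_factor (B : H -> H) (h K : R) : linear B -> 0 < h -> 0 < K ->
  (forall x y, rdot dot (B x) y = rdot dot x (B y)) ->
  (forall x, h * rnorm x ^+ 2 <= rdot dot (B x) x <= K * rnorm x ^+ 2) ->
  exists L Li, op_inverse L Li /\ forall x, rnorm (L x) ^+ 2 = rdot dot (B x) x.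
Proof.
(* With M = K + h the form of C = 1 - B / M lies between 0 and 1 - h / M = K / M = q < 1. Then B = M
   (1 - Y)^2, and L = sqrt(M) (1 - Y) is inverted by a Neumann series. *)
move=> linB h0 K0 sB fB; pose M := K + h; have M0 : 0 < M by rewrite addr_gt0.
have Mi0 : 0 < M^-1 by rewrite invr_gt0.
pose C x := x - (M^-1)%:C *: B x; pose q := K / M.
have q0 : 0 < q by rewrite divr_gt0.
have q1 : q < 1 by rewrite ltr_pdivrMr // mul1r ltrDl.
have linC : linear C.
  move=> c x y; rewrite /C linB (scalerDr (M^-1)%:C) opprD addrACA scalerBr !scalerA.
  by rewrite [c * _]mulrC.
have sC x y : rdot dot (C x) y = rdot dot x (C y).
  by rewrite rdotBl rdotBr rdotZl rdotZr sB.
have fC x : 0 <= rdot dot (C x) x <= q * rnorm x ^+ 2.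
  rewrite rdotBl rdotZl (rdotxx hdot); have /andP[h1 h2] := fB x; have h3 := sqr_ge0 (rnorm x).
  rewrite subr_ge0 ler_pdivrMl // lerBlDr -lerBlDl ler_pdivlMl //.
  have -> : M * (rnorm x ^+ 2 - q * rnorm x ^+ 2) = h * rnorm x ^+ 2.
    have qM : M * q = K by rewrite /q mulrC divfK ?gt_eqF.
    by rewrite mulrBr (mulrA M q) qM /M; ring.
  by rewrite h1 andbT /M mulrDl; apply: le_trans h2 _; rewrite lerDl mulr_ge0 // ltW.
have [|Y [linY bY sY YE]] := one_sub_sqrt _ linC sC (bnd_of_form linC q0 sC fC).
  by rewrite q0 q1.
have [|W [linW bW WY YW]] := one_sub_inverse _ linY bY; first by rewrite ltW.
pose s := Num.sqrt M; have s0 : 0 < s by rewrite sqrtr_gt0.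
have ss : s ^+ 2 = M by rewrite sqr_sqrtr // ltW.
have sC1 : s%:C * (s^-1)%:C = 1 by rewrite -rmorphM mulfV ?gt_eqF.
exists (fun x => s%:C *: (x - Y x)), (fun x => (s^-1)%:C *: W x).
split; first split.
- apply/bounded_opP; split.
    move=> c x y; rewrite linY scalerA [c * _]mulrC -scalerA -scalerDr; congr (_ *: _).
    by rewrite scalerBr opprD addrACA.
  exists (s * (1 + q)); first by rewrite mulr_ge0 ?(ltW s0) //; lra.
  move=> x; rewrite rnormZr gtr0_norm // -mulrA ler_pM2l // mulrDl mul1r.
  by apply: le_trans (ler_rnormB _ _) _; rewrite lerD2l.
- apply/bounded_opP; split.
    by move=> c x y; rewrite linW scalerA [c * _]mulrC -scalerA -scalerDr.
  exists (s^-1 * (1 - q)^-1); first by rewrite mulr_ge0 ?invr_ge0 ?(ltW s0) // subr_ge0 ltW.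
  by move=> x; rewrite rnormZr gtr0_norm ?invr_gt0 // -mulrA ler_pM2l ?invr_gt0.
- by move=> x; rewrite (linear_funZ linW) WY scalerA mulrC sC1 scale1r.
- by move=> x; rewrite (linear_funZ linY) -scalerBr YW scalerA sC1 scale1r.
move=> x; rewrite rnormZr exprMn gtr0_norm // ss (rnormB_sqr hdot).
have -> : rnorm (Y x) ^+ 2 = rdot dot (Y (Y x)) x by rewrite -(rdotxx hdot) sY rdotC.
have := congr1 (fun z => rdot dot z x) (YE x).
rewrite rdotZl rdotDl /C rdotBl rdotZl (rdotxx hdot) (rdotC dot (Y x) x).
move=> /(congr1 (fun z => M * z)).
rewrite !mulrDr mulrN (mulrA M M^-1) mulfV ?gt_eqF // mul1r => e.
by rewrite mulrN; lra.
Qed.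

End OperatorSquareRoot.

(** * Growth of powers under a spectral bound *)

Section SpectralRadius.
Variables (R : realType) (H : completeNormedModType R[i]).
Implicit Types (A W T : H -> H) (M r : R) (z w : R[i]).

(** The inverse of 1 - A, used with A = z T: the parameter z is the inverse of a spectral value, and
    z = 0 is included. *)
Definition resolvent A W M := [/\ linear W, bnd W M,
  forall x, W (x - A x) = x & forall x, W x - A (W x) = x].

Lemma resolvent_exists T z : bounded_op T -> op_spectrum T `<=` [set l | `|l| <= 1] ->
  `|z| < 1 -> exists W M, 0 < M /\ resolvent (fun x => z *: T x) W M.
Proof.
move=> bT sT z1; have [->|z0] := eqVneq z 0.
  exists id, 1; split=> //; split=> //.
  - by move=> x; rewrite mul1r.
  - by move=> x; rewrite scale0r subr0.
  - by move=> x; rewrite scale0r subr0.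
have [S [_ bS SK KS]] : exists S, op_inverse (fun x => T x - z^-1 *: x) S.
  apply: contrapT => nS; have /= := sT z^-1 nS.
  by rewrite normfV invf_le1 ?normr_gt0 // (lt_geF z1).
have [linS [M M0 bndS]] := (bounded_opP S).1 bS.
have zE x : x - z *: T x = - z *: (T x - z^-1 *: x).
  by rewrite scaleNr scalerBr scalerA mulfV // scale1r opprB.
exists (fun x => - z^-1 *: S x), (complex.Re `|z^-1| * M + 1).
have n0 : 0 <= complex.Re `|z^-1| := Re_normc_ge0 _.
split; first by rewrite ltr_wpDl // mulr_ge0.
split.
- by move=> c x y; rewrite linS scalerDr !scalerA (mulrC c).
- move=> x; rewrite rnormZ normrN mulrDl mul1r -mulrA.
  by apply: (le_trans (ler_wpM2l n0 (bndS x))); rewrite lerDl rnorm_ge0.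
- by move=> x; rewrite zE (linear_funZ linS) SK scalerA mulrNN mulVf // scale1r.
- move=> x; rewrite zE (linear_funZ bT.1) scalerA mulrC -scalerA -scalerBr KS.
  by rewrite scalerA mulrNN mulfV // scale1r.
Qed.

(* [1 - wT = (1 - (w - z) T W) (1 - zT)] when [W] inverts [1 - zT]. *)
Lemma resolvent_open T z w W M Mt : linear T -> 0 <= Mt -> bnd T Mt -> 0 < M ->
  resolvent (fun x => z *: T x) W M -> complex.Re `|w - z| * Mt * M <= 2^-1 ->
  exists W', resolvent (fun x => w *: T x) W' (M * 2).
Proof.
move=> linT Mt0 bT M0 [linW bW WK KW] wz.
have n0 : 0 <= complex.Re `|w - z| := Re_normc_ge0 _.
have [|||V [linV bV VK KV]] := @one_sub_inverse _ _ (fun x => (w - z) *: T (W x)) (2^-1).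
- by apply/andP; split; lra.
- by move=> c x y; rewrite linW linT scalerDr !scalerA (mulrC c).
- move=> x; rewrite rnormZ; apply: le_trans (ler_wpM2r (rnorm_ge0 x) wz).
  rewrite -!mulrA; apply: ler_wpM2l => //; apply: le_trans (bT _) _.
  exact: ler_wpM2l.
have V2 : (1 - 2^-1)^-1 = 2 :> R by rewrite (_ : 1 - 2^-1 = 2^-1) ?invrK //; lra.
rewrite V2 in bV.
have wE y : y - w *: T y = (y - z *: T y) - (w - z) *: T (W (y - z *: T y)).
  by rewrite WK scalerBl opprB addrA subrK.
exists (W \o V); split.
- by move=> c x y /=; rewrite linV linW.
- exact: bnd_comp (ltW M0) bW bV.
- by move=> x /=; rewrite wE VK WK.
- by move=> x /=; rewrite wE KW KV.
Qed.

Lemma resolvent_le A W M M' : M <= M' -> resolvent A W M -> resolvent A W M'.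
Proof.
move=> MM' [linW bW WK KW]; split=> // x.
by apply: le_trans (bW x) _; rewrite ler_wpM2r ?rnorm_ge0.
Qed.

(** The local bounds of [resolvent_open] become one bound by compactness of a square of pairs (Re z,
    Im z), with the integer n serving as the bound. *)
Lemma resolvent_bounded T r : bounded_op T -> op_spectrum T `<=` [set l | `|l| <= 1] ->
  0 <= r < 1 -> exists M, 0 < M /\
    forall z, complex.Re `|z| <= r -> exists W, resolvent (fun x => z *: T x) W M.
Proof.
move=> bT sT /andP[r0 r1].
have [linT [Mt Mt0 bndT]] := (bounded_opP T).1 bT.
pose K : set (R * R) := `[-1, 1]%classic `*` `[-1, 1]%classic.
have cK : compact K by apply: compact_setX; exact: segment_compact.
pose P (n : nat) (p : R * R) := complex.Re `|p.1 +i* p.2| <= r ->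
  exists W, resolvent (fun x => (p.1 +i* p.2) *: T x) W n%:R.
have ballP (p : R * R) (d : R) (N : nat) : 0 < d ->
    (forall p' n, (N <= n)%N -> complex.Re `|(p'.1 +i* p'.2) - (p.1 +i* p.2)| <= d -> P n p') ->
    \forall p0 \near p & n \near \oo, P n p0.
  move=> d0 h; exists (ball p (d / 2), [set n | (N <= n)%N]).
    by split; [apply: nbhsx_ballx; rewrite divr_gt0 | exists N].
  move=> [p' n] [/= [b1 b2] Nn]; apply: h => //.
  apply: le_trans (Re_normc_le _ _) _.
  move: b1 b2; rewrite /= /ball /= (distrC p.1) (distrC p.2) => b1 b2.
  by lra.
have hP p : K p -> \forall p0 \near p & n \near \oo, P n p0.
  move=> _; have [p1|p1] := ltP (complex.Re `|p.1 +i* p.2|) 1.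
    have [|W [M [M0 res]]] := @resolvent_exists T (p.1 +i* p.2) bT sT.
      by rewrite -[`|_|]RRe_real ?normr_real // ltcR.
    have [N hN] : exists N, M * 2 <= N%:R.
      by exists (Num.bound (M * 2)); apply: ltW; apply: archi_boundP; rewrite mulr_ge0 // ltW.
    have MM : 0 < (Mt + 1) * M * 2 by rewrite !mulr_gt0 // ltr_wpDl.
    apply: (ballP p ((Mt + 1) * M * 2)^-1 N); first by rewrite invr_gt0.
    move=> p' n Nn pd _.
    have [|W' res'] := resolvent_open linT Mt0 bndT M0 res (w := p'.1 +i* p'.2).
      have h : complex.Re `|(p'.1 +i* p'.2) - (p.1 +i* p.2)| * ((Mt + 1) * M * 2) <= 1.
        by rewrite -ler_pdivlMr // div1r.
      have h0 : 0 <= complex.Re `|(p'.1 +i* p'.2) - (p.1 +i* p.2)|.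
        exact: Re_normc_ge0.
      move: h h0; set e := complex.Re _ => h h0.
      by have := mulr_ge0 h0 (ltW M0); lra.
    by exists W'; apply: resolvent_le res'; apply: le_trans hN _; rewrite ler_nat.
  (* When |p| >= 1, the points within (1 - r) / 2 of p lie outside the disc of radius r, and the
     claim is vacuous there. *)
  apply: (ballP p ((1 - r) / 2) 0%N); first by rewrite divr_gt0 // subr_gt0.
  move=> p' n _ pd pr.
  have := ler_normD (p'.1 +i* p'.2) ((p.1 +i* p.2) - (p'.1 +i* p'.2)).
  rewrite addrC subrK distrC.
  rewrite -[`|p.1 +i* p.2|]RRe_real ?normr_real // -[`|p'.1 +i* p'.2|]RRe_real ?normr_real //.
  rewrite -[`|_ - _|]RRe_real ?normr_real // -rmorphD lecR.
  by move: pr pd p1; lra.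
have [N _ hN] := (compact_near_coveringP K).1 cK _ _ _ _ hP.
exists (N.+1)%:R; split=> [|[x y] xy]; first exact: ltr0Sn.
have c1 : -1 <= x <= 1 /\ -1 <= y <= 1.
  rewrite -!ler_norml.
  have : `|x +i* y| <= 1 by rewrite -[`|_|]RRe_real ?normr_real // lecR (le_trans xy) // ltW.
  move=> h; split; rewrite -lecR; apply: le_trans h.
    exact: (normc_ge_Re (x +i* y)).
  by rewrite normc_def lecR -sqrtr_sqr ler_wsqrtr //= lerDr sqr_ge0.
apply: (hN N.+1 _ (x, y)) => //=.
Qed.

(** Partial fractions: 1 / (1 - A^2) is the mean of 1 / (1 - A) and 1 / (1 + A), so the bound M is
    kept. *)
Lemma resolvent_half_sum A Wp Wm M : linear A ->
  resolvent A Wp M -> resolvent (fun x => - A x) Wm M ->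
  resolvent (A \o A) (fun x => (2^-1)%:C *: (Wp x + Wm x)) M.
Proof.
move=> linA [linp bp pK Kp] [linm bm mK Km].
have half2 (x : H) : (2^-1)%:C *: (x + x) = x.
  rewrite -[x in x + x]scale1r -scalerDl scalerA -(rmorph1 (real_complex R)).
  by rewrite -rmorphD -rmorphM mulVf ?scale1r.
have mK' x : Wm (x + A x) = x by rewrite -[A x]opprK mK.
have Km' x : Wm x + A (Wm x) = x by rewrite -[A _]opprK Km.
split.
- move=> c x y; rewrite linp linm addrACA -scalerDr (scalerDr (2^-1)%:C) !scalerA.
  by rewrite (mulrC c).
- move=> x; rewrite rnormZr ger0_norm ?invr_ge0 //.
  by have := ler_rnormD (Wp x) (Wm x); have := bp x; have := bm x; lra.
- move=> x /=.
  have -> : Wp (x - A (A x)) = x + A x.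
    by rewrite -[RHS]pK (linear_funD linA) opprD addrA addrK.
  have -> : Wm (x - A (A x)) = x - A x.
    by rewrite -[RHS]mK' (linear_funB linA) addrA subrK.
  by rewrite addrACA subrr addr0 half2.
- move=> x /=; rewrite (linear_funZ linA) (linear_funZ linA) -scalerBr.
  rewrite !(linear_funD linA) opprD addrACA.
  have -> : Wp x - A (A (Wp x)) = x + A x.
    by rewrite -[in RHS](Kp x) (linear_funB linA) addrA subrK.
  have -> : Wm x - A (A (Wm x)) = x - A x.
    by rewrite -[in RHS](Km' x) (linear_funD linA) opprD addrA addrK.
  by rewrite addrACA subrr addr0 half2.
Qed.

(** Replacing z by w z changes the sign of (z T)^(2^j), which supplies the second resolvent of the
    mean. *)
Lemma root_of_minus_one j : exists2 w : R[i], `|w| = 1 & w ^+ (2 ^ j) = -1.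
Proof.
elim: j => [|j [w w1 wj]]; first by exists (-1); rewrite ?normrN1 ?expr1.
exists (sqrtc w); last by rewrite expnS exprM sqr_sqrtc.
apply/eqP; rewrite -sqrp_eq1 ?normr_ge0 // -normrX sqr_sqrtc w1.
by [].
Qed.

(* The average of the resolvents of [T] over the [2^j]-th roots of unity
   inverts [1 - (zT)^(2^j)], with bounds that do not depend on [j]. *)
Lemma power_resolvent T r M : bounded_op T -> 0 < M ->
  (forall z, complex.Re `|z| <= r -> exists W, resolvent (fun x => z *: T x) W M) ->
  exists L, 0 <= L /\ forall j, exists G : R[i] -> H -> H,
    (forall z, complex.Re `|z| <= r ->
      resolvent (fun x => z ^+ (2 ^ j) *: iter (2 ^ j) T x) (G z) M) /\
    (forall z w x, complex.Re `|z| <= r -> complex.Re `|w| <= r ->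
      rnorm (G z x - G w x) <= L * complex.Re `|z - w| * rnorm x).
Proof.
move=> bT M0 hr; have [linT [Mt Mt0 bndT]] := (bounded_opP T).1 bT.
exists (M * Mt * M); split; first by rewrite !mulr_ge0 // ltW.
elim=> [|j [G [Gr GL]]].
  have /choice [G hG] : forall z, exists W, complex.Re `|z| <= r ->
      resolvent (fun x => z *: T x) W M.
    move=> z; have [zr|zr] := boolP (complex.Re `|z| <= r); last by exists id.
    by have [W] := hr z zr; exists W.
  exists G; split=> [z zr|z w x zr wr]; first exact: hG.
  have [linz bz zK Kz] := hG z zr; have [_ bw wK Kw] := hG w wr.
  (* The resolvent identity, the origin of the Lipschitz constant M Mt M. *)
  have -> : G z x - G w x = G z ((z - w) *: T (G w x)).
    transitivity (G z (G w x - w *: T (G w x)) - G z (G w x - z *: T (G w x))).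
      by rewrite Kw zK.
    rewrite -(linear_funB linz); congr (G z _).
    by rewrite opprD addrACA subrr add0r opprK scalerBl addrC.
  apply: le_trans (bz _) _; rewrite rnormZ.
  have n0 : 0 <= complex.Re `|z - w| := Re_normc_ge0 _.
  rewrite [leRHS](_ : _ = M * (complex.Re `|z - w| * (Mt * (M * rnorm x)))); last by ring.
  rewrite ler_pM2l //; apply: ler_wpM2l => //.
  by apply: le_trans (bndT _) _; apply: ler_wpM2l.
have [i i1 ij] := root_of_minus_one j.
have ir z : complex.Re `|z| <= r -> complex.Re `|i * z| <= r by rewrite normrM i1 mul1r.
exists (fun z x => (2^-1)%:C *: (G z x + G (i * z) x)); split.
  move=> z zr; set A := fun x => z ^+ (2 ^ j) *: iter (2 ^ j) T x.
  have linA : linear A.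
    by move=> c x y; rewrite /A (linear_iter linT) scalerDr !scalerA (mulrC c).
  rewrite (_ : (fun x => _ *: _) = A \o A); last first.
    apply/funext => x; rewrite /A /= (linear_funZ (linear_iter linT _)) scalerA -exprD.
    by rewrite -iterD addnn -mul2n -expnS.
  apply: resolvent_half_sum => //; first exact: Gr.
  have := Gr _ (ir z zr); rewrite exprMn ij mulN1r.
  by under [X in resolvent X _ _]eq_fun do rewrite scaleNr.
move=> z w x zr wr; rewrite -scalerBr rnormZr ger0_norm ?invr_ge0 //.
rewrite opprD addrACA; apply: le_trans (ler_wpM2l _ (ler_rnormD _ _)) _.
  by rewrite invr_ge0.
have := GL _ _ x zr wr; have := GL _ _ x (ir z zr) (ir w wr).
by rewrite -mulrBr normrM i1 mul1r; lra.
Qed.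

(* If [(rho T)^(2^j)] is small then the inverse of [1 - (rho T)^(2^(j+1))] is
   close to 1, hence so is the inverse for [rho + d], by equicontinuity in [j]. *)
Lemma power_bound_step T r M L (d rho : R) j (G : R[i] -> H -> H) : bounded_op T ->
  (forall z, complex.Re `|z| <= r ->
      resolvent (fun x => z ^+ (2 ^ j.+1) *: iter (2 ^ j.+1) T x) (G z) M) ->
  (forall z w x, complex.Re `|z| <= r -> complex.Re `|w| <= r ->
      rnorm (G z x - G w x) <= L * complex.Re `|z - w| * rnorm x) ->
  0 <= d -> 0 <= rho -> rho + d <= r -> L * d <= 8^-1 ->
  bnd (fun x => (rho%:C ^+ (2 ^ j)) *: iter (2 ^ j) T x) 3^-1 ->
  bnd (fun x => ((rho + d)%:C ^+ (2 ^ j.+1)) *: iter (2 ^ j.+1) T x) 3^-1.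
Proof.
move=> bT hG hL d0 rho0 rhod Ld hb.
have Ren (c : R) : 0 <= c -> complex.Re `|c%:C| = c.
  by move=> c0; rewrite normcR ger0_norm.
have r1 : complex.Re `|rho%:C| <= r by rewrite Ren //; lra.
have r2 : complex.Re `|(rho + d)%:C| <= r by rewrite Ren //; lra.
have linT := bT.1.
have [linG bG GK KG] := hG _ r1; have [linG' bG' GK' KG'] := hG _ r2.
set A' := fun x => ((rho + d)%:C ^+ (2 ^ j.+1)) *: iter (2 ^ j.+1) T x in GK' KG' *.
set A := fun x => (rho%:C ^+ (2 ^ j.+1)) *: iter (2 ^ j.+1) T x in GK KG *.
have bA : bnd A 9^-1.
  have -> : A = (fun x => (rho%:C ^+ (2 ^ j)) *: iter (2 ^ j) T x) \o
                (fun x => (rho%:C ^+ (2 ^ j)) *: iter (2 ^ j) T x).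
    apply/funext => x; rewrite /A /= (linear_funZ (linear_iter linT _)) scalerA -exprD.
    by rewrite -iterD addnn -mul2n -expnS.
  have -> : 9^-1 = 3^-1 * 3^-1 :> R by rewrite -invfM; congr (_^-1); ring.
  by apply: bnd_comp => //; rewrite invr_ge0.
move=> y; set x := y - A' y.
(* Since |A| <= 1/9, G_rho x is within (1/9) / (1 - 1/9) = 1/8 of x, relative to |x|. Equicontinuity
   adds 1/8, so |A' y| = |y - x| <= |x| / 4 <= (|y| + |A' y|) / 4, which is |A' y| <= |y| / 3. *)
have Gx : rnorm (G rho%:C x - x) <= 8^-1 * rnorm x.
  have e : G rho%:C x - x = A (G rho%:C x) by rewrite -{2}(KG x) opprB addrC subrK.
  have h1 := bA (G rho%:C x); rewrite -e in h1.
  have := ler_rnormD (G rho%:C x - x) x; rewrite subrK => h2.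
  by have := rnorm_ge0 x; lra.
have G'x : G (rho + d)%:C x = y by rewrite GK'.
have := hL _ _ x r2 r1; rewrite -rmorphB (_ : rho + d - rho = d); last by ring.
rewrite Ren // G'x => h1.
have h2 : L * d * rnorm x <= 8^-1 * rnorm x by rewrite ler_wpM2r ?rnorm_ge0.
have := ler_rnormD (y - G rho%:C x) (G rho%:C x - x).
rewrite addrA subrK (_ : y - x = A' y) => [h3|]; last by rewrite /x opprB addrC subrK.
have := ler_rnormB y (A' y); rewrite -/x => h4.
by lra.
Qed.

(** The radius grows from 0 to r in N + 1 steps of length d, each doubling the exponent. As L is
    independent of j, a single d with L d <= 1/8 serves for all steps. *)
Lemma spectral_power_bound T r : bounded_op T -> op_spectrum T `<=` [set l | `|l| <= 1] ->
  0 <= r < 1 ->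
  exists m, (0 < m)%N /\ bnd (fun x => r%:C ^+ m *: iter m T x) 3^-1.
Proof.
move=> bT sT /[dup] r01 /andP[r0 r1].
have [M [M0 hM]] := resolvent_bounded bT sT r01.
have [L [L0 hL]] := power_resolvent bT M0 hM.
have [N hN] : exists N, L * 8 < N%:R.
  by exists (Num.bound (L * 8)); apply: archi_boundP; rewrite mulr_ge0.
pose d := r / N.+1%:R; have d0 : 0 <= d by rewrite divr_ge0.
have Ld : L * d <= 8^-1.
  rewrite /d mulrA ler_pdivrMr ?ltr0n //.
  have : (N%:R : R) <= N.+1%:R by rewrite ler_nat.
  have : L * r <= L by rewrite ler_piMr // ltW.
  by lra.
have step k : (k <= N.+1)%N -> bnd (fun x => (k%:R * d)%:C ^+ (2 ^ k) *: iter (2 ^ k) T x) 3^-1.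
  elim: k => [_ x|k IH kN].
    by rewrite mul0r expr1 scale0r rnorm0 mulr_ge0 ?rnorm_ge0 ?invr_ge0.
  have [G [Gr GL]] := hL k.+1.
  rewrite -(addn1 k) natrD mulrDl mul1r addn1.
  apply: (power_bound_step bT Gr GL) (IH (ltnW kN)) => //; first by rewrite mulr_ge0.
  rewrite -[X in _ + X]mul1r -mulrDl natr1 /d mulrCA ler_piMr //.
  by rewrite ler_pdivrMr ?ltr0n // mul1r ler_nat.
exists (2 ^ N.+1)%N; rewrite expn_gt0; split=> //.
by have := step _ (leqnn _); rewrite /d mulrCA mulfV ?mulr1 // pnatr_eq0.
Qed.

Lemma iter_bound T r : bounded_op T -> op_spectrum T `<=` [set l | `|l| <= 1] ->
  0 <= r < 1 -> exists2 C, 0 <= C & forall n, bnd (fun x => r%:C ^+ n *: iter n T x) C.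
Proof.
move=> bT sT /[dup] r01 /andP[r0 r1].
have [linT [Mt Mt0 bndT]] := (bounded_opP T).1 bT.
have [m [m0 hm]] := spectral_power_bound bT sT r01.
exists ((1 + Mt) ^+ m); first by rewrite exprn_ge0 // addr_ge0.
elim/ltn_ind => n IH x; have [nm|mn] := ltnP n m.
  rewrite rnormZ normrX normcR ger0_norm // -rmorphXn /=.
  apply: le_trans (_ : _ <= 1 * (Mt ^+ n * rnorm x)) _.
    apply: ler_pM; rewrite ?exprn_ge0 ?rnorm_ge0 //; first by rewrite exprn_ile1 // ltW.
    exact: bnd_iter.
  rewrite mul1r; apply: ler_wpM2r; first exact: rnorm_ge0.
  apply: le_trans (_ : _ <= (1 + Mt) ^+ n) _.
    by rewrite lerXn2r // ?nnegrE ?addr_ge0 // lerDr.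
  by rewrite ler_weXn2l ?lerDl // ltnW.
have := hm (r%:C ^+ (n - m) *: iter (n - m) T x).
rewrite (linear_funZ (linear_iter linT _)) scalerA -exprD -iterD subnKC // => h.
apply: le_trans h _.
have nmn : (n - m < n)%N by rewrite ltn_subrL m0 (leq_trans m0 mn).
have h1 := IH _ nmn x.
have : 0 <= (1 + Mt) ^+ m * rnorm x by rewrite mulr_ge0 ?rnorm_ge0 ?exprn_ge0 ?addr_ge0.
by lra.
Qed.

Lemma hbnd_geometric T (z : R) : bounded_op T -> op_spectrum T `<=` [set l | `|l| <= 1] ->
  1 < z -> exists2 K, 0 <= K & hbnd T (fun n => z^-1 ^+ n) K.
Proof.
move=> bT sT z1; have z0 : 0 < z by lra.
have zi1 : z^-1 < 1 by rewrite invf_lt1.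
have zi0 : 0 < z^-1 by rewrite invr_gt0.
(* By AM-GM r^2 > 1 / z, so z^-n |T^n x|^2 is dominated by a geometric sequence of ratio s = 1 / (z
   r^2) < 1. *)
pose r := (1 + z^-1) / 2.
have r01 : 0 <= r < 1 by rewrite /r; apply/andP; split; lra.
have r0 : 0 < r by rewrite /r; lra.
have [C C0 hC] := iter_bound bT sT r01.
pose s := z^-1 / r ^+ 2.
have s0 : 0 <= s by rewrite divr_ge0 ?exprn_ge0 ?ltW.
have s1 : s < 1.
  by rewrite /s ltr_pdivrMr ?exprn_gt0 // mul1r /r; have := sqr_ge0 (1 - z^-1); nra.
have rT n x : rnorm (iter n T x) <= C / r ^+ n * rnorm x.
  have := hC n x; rewrite rnormZ normrX normcR gtr0_norm // -rmorphXn /= => h.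
  by rewrite mulrAC ler_pdivlMr ?exprn_gt0 // mulrC.
exists (C ^+ 2 / (1 - s)); first by rewrite divr_ge0 ?exprn_ge0 // subr_ge0 ltW.
move=> x N; apply: (@le_trans _ _ (\sum_(n < N) C ^+ 2 * rnorm x ^+ 2 * s ^+ n)).
  apply: ler_sum => n _; rewrite ger0_norm ?exprn_ge0 ?(ltW zi0) //.
  apply: (@le_trans _ _ (z^-1 ^+ n * (C / r ^+ n * rnorm x) ^+ 2)).
    rewrite ler_wpM2l ?exprn_ge0 ?(ltW zi0) // lerXn2r ?nnegrE ?rnorm_ge0 //.
    by rewrite !mulr_ge0 ?invr_ge0 ?exprn_ge0 ?rnorm_ge0 // ltW.
  have -> : s ^+ n = z^-1 ^+ n / (r ^+ n) ^+ 2 by rewrite /s expr_div_n -!exprM mulnC.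
  rewrite le_eqVlt; apply/orP; left; apply/eqP; move: (z^-1 ^+ n) (r ^+ n) => p q.
  by rewrite !exprMn -exprVn; ring.
rewrite -mulr_sumr -[leRHS]mulrAC ler_wpM2l ?mulr_ge0 ?sqr_ge0 ?rnorm_ge0 //.
rewrite -[leRHS]mul1r ler_pdivlMr ?subr_gt0 //.
have -> : (\sum_(i < N) s ^+ i) * (1 - s) = 1 - s ^+ N.
  elim: N => [|N IH]; first by rewrite big_ord0 mul0r expr0 subrr.
  by rewrite big_ord_recr /= mulrDl IH exprS; ring.
by rewrite gerBl exprn_ge0.
Qed.

End SpectralRadius.

(** * Construction of the multiplier *)

Section Multiplier.
Variables (R : realType) (H : completeNormedModType R[i]).
Variable T : H -> H.
Implicit Types (f g e s : nat -> R).

Lemma prefix_lower_bound g (C : R) (h : R -> R) : (forall N, \sum_(n < N) `|g n| <= C) ->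
  (forall t, 0 <= t <= 1 -> 0 < h t /\ (fun N => \sum_(n < N) g n * t ^+ n) @ \oo --> h t) ->
  exists2 d : R, 0 < d & exists N, forall M t, (N <= M)%N -> 0 <= t <= 1 ->
    d <= \sum_(n < M) g n * t ^+ n.
Proof.
move=> gC hP; pose q M t := \sum_(n < M) g n * t ^+ n.
(* One index serves both as threshold and as reciprocal of the lower bound, in the form compactness
   asks for. *)
pose P (N : nat) (t : R) := 0 <= t <= 1 -> forall M, (N <= M)%N -> N.+1%:R^-1 <= q M t.
have tail (eps : R) : 0 < eps -> exists N, forall M, (N <= M)%N -> \sum_(N <= n < M) `|g n| <= eps.
  move=> eps0; have : cvgn (fun N => \sum_(n < N) `|g n|).
    apply: nondecreasing_is_cvgn; last by exists C => _ [N _ <-].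
    by move=> m n mn; apply: (@ler_sum_prefix _ (fun k => `|g k|)).
  move=> /cvgrPdist_le /(_ (eps / 2)) [|N _ hN]; first by rewrite divr_gt0.
  exists N => M NM; have := hN _ NM; have := hN _ (leqnn N).
  rewrite /= !ler_norml (sum_prefix_split (fun n => `|g n|) NM) => /andP[h1 h2] /andP[h3 h4].
  by lra.
have qtail N M t : (N <= M)%N -> 0 <= t <= 1 -> `|q M t - q N t| <= \sum_(N <= n < M) `|g n|.
  move=> NM /andP[t0 t1]; rewrite /q (sum_prefix_split (fun n => g n * t ^+ n) NM).
  rewrite addrAC subrr add0r.
  apply: le_trans (ler_norm_sum _ _ _) _; apply: ler_sum => n _.
  by rewrite normrM ler_piMr // ger0_norm ?exprn_ge0 // exprn_ile1.
have hnear (t : R) : `[0, 1]%classic t -> \forall t' \near t & n \near \oo, P n t'.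
  rewrite /= in_itv /= => t01; have [h0 qh] := hP t t01.
  (* Three errors of h t / 5 (limit, continuity of [q N], tail) leave 2 h t / 5, above the bound
     1/(n+1) <= h t / 5. *)
  have eta0 : 0 < h t / 5 by rewrite divr_gt0.
  have [N hN] := tail _ eta0.
  have hqN : `|h t - q N t| <= h t / 5.
    apply: (@cvg_norm_le _ (fun M => q M t - q N t) _ _ N); last first.
      by move=> M NM; apply: le_trans (qtail N M t NM t01) (hN M NM).
    by apply: cvgB; [exact: qh | exact: cvg_cst].
  have [N' hN'] : exists N', (h t / 5)^-1 < N'%:R.
    by exists (Num.bound (h t / 5)^-1); apply: archi_boundP; rewrite invr_ge0 ltW.
  have qc : {for t, continuous (q N)}.
    rewrite (_ : q N = horner (\poly_(i < N) g i)); last first.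
      by apply/funext => u; rewrite horner_poly.
    exact: continuous_horner.
  have /cvgrPdist_le /(_ _ eta0) nt : q N x @[x --> t] --> q N t := qc.
  exists ([set t' | `|q N t - q N t'| <= h t / 5], [set n | (maxn N N' <= n)%N]).
    by split=> //=; exists (maxn N N').
  move=> [t' n] [/= h1]; rewrite geq_max => /andP[Nn N'n] t'01 M nM.
  have NM := leq_trans Nn nM.
  have h2 := le_trans (qtail N M t' NM t'01) (hN M NM).
  have h3 : n.+1%:R^-1 <= h t / 5.
    rewrite -[leRHS]invrK lef_pV2 ?posrE ?invr_gt0 ?ltr0n //.
    by apply: le_trans (ltW hN') _; rewrite ler_nat (leq_trans N'n).
  move: h1 h2 hqN; rewrite !ler_norml => /andP[_ h4] /andP[h5 _] /andP[_ h6].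
  by move: (n.+1%:R^-1) h3 => i h3; lra.
have [N _ hN] := (compact_near_coveringP _).1 (@segment_compact R 0 1) _ _ _ _ hnear.
exists N.+1%:R^-1; first by rewrite invr_gt0 ltr0n.
exists N => M t NM t01; apply: (hN N (leqnn N) t _ t01 M NM).
by rewrite /= in_itv.
Qed.

(** From s = 1 + e s, the sum for s at x is at most |x|^2 + sum_k e_k 2 |T^k x|^2 <= 2 |x|^2. The
    induction on N is well founded because e_0 = 0 leaves only inner sums of length N - k < N. *)
Lemma hbnd_inverse e s : (forall n, 0 <= e n) -> hbnd T e 2^-1 ->
  s 0%N = 1 -> (forall n, 0 <= s n) -> e 0%N = 0 ->
  (forall n, s n.+1 = cprod e s n.+1) -> hbnd T s 2.
Proof.
move=> ege eb s0 sge e0 sS x N; elim/ltn_ind: N x => N IH x.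
pose u n := rnorm (iter n T x) ^+ 2.
have -> : \sum_(n < N) `|s n| * u n = \sum_(n < N) ((n == 0%N :> nat)%:R * u n + cprod e s n * u n).
  apply: eq_bigr => -[[|n] nN] _ /=; rewrite ger0_norm //.
    by rewrite s0 cprod_at0 e0 !mul0r addr0.
  by rewrite sS mul0r add0r.
rewrite big_split /= sum_cprod.
have -> : 2 * rnorm x ^+ 2 = rnorm x ^+ 2 + 2 * (2^-1 * rnorm x ^+ 2).
  by rewrite mulrA mulfV ?mul1r //; ring.
apply: lerD.
  case: N {IH} => [|N]; first by rewrite big_ord0 sqr_ge0.
  rewrite big_ord_recl big1 ?addr0 ?mul1r // => n _.
  by rewrite mul0r.
apply: le_trans (ler_wpM2l (ler0n _ 2) (eb x N)).
rewrite mulr_sumr; apply: ler_sum => k _.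
have [->|k0] := posnP k.
  by rewrite e0 normr0 mul0r mulr0 big1 // => m _; rewrite !mul0r.
rewrite ger0_norm // mulrCA.
have Nk : (N - k < N)%N by rewrite ltn_subrL k0 (leq_ltn_trans _ (ltn_ord k)).
apply: le_trans (ler_wpM2l (ege k) (IH _ Nk (iter k T x))).
rewrite mulr_sumr le_eqVlt; apply/orP; left; apply/eqP; apply: eq_bigr => m _.
by rewrite (ger0_norm (sge m)) /u addnC iterD [RHS]mulrA.
Qed.

Lemma hbnd_poly (p : {poly R}) M : 0 <= M -> bnd T M ->
  exists2 K, 0 <= K & hbnd T (fun n => p`_n) K.
Proof.
move=> M0 bT; exists (\sum_(n < size p) `|p`_n| * (M ^+ n) ^+ 2).
  by apply: sumr_ge0 => n _; rewrite mulr_ge0 ?sqr_ge0.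
move=> x N.
pose v n := `|p`_n| * rnorm (iter n T x) ^+ 2.
have v0 n : 0 <= v n by rewrite mulr_ge0 ?sqr_ge0.
apply: (@le_trans _ _ (\sum_(n < size p) v n)).
  apply: le_trans (ler_sum_prefix v0 (leq_addl (size p) N)) _.
  rewrite (sum_prefix_split v (leq_addr N (size p))) gerDl big_nat_cond big1 //.
  by move=> i /andP[/andP[pi _] _]; rewrite /v nth_default // normr0 mul0r.
rewrite mulr_suml; apply: ler_sum => n _; rewrite /v -mulrA ler_wpM2l //.
rewrite -exprMn lerXn2r ?nnegrE ?rnorm_ge0 ?mulr_ge0 ?exprn_ge0 ?rnorm_ge0 //.
exact: bnd_iter.
Qed.

Lemma hbnd_le f g K : (forall n, `|f n| <= `|g n|) -> hbnd T g K -> hbnd T f K.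
Proof.
move=> fg gK x N; apply: le_trans (gK x N); apply: ler_sum => n _.
by rewrite ler_wpM2r ?sqr_ge0.
Qed.

Lemma hbnd_scale f (c K : R) : hbnd T f K -> hbnd T (fun n => c * f n) (`|c| * K).
Proof.
move=> fK x N; under eq_bigr do rewrite normrM -mulrA.
by rewrite -mulr_sumr -mulrA ler_wpM2l //; exact: fK.
Qed.

Lemma nonneg_multiplier g (C : R) (h : R -> R) :
  bounded_op T -> op_spectrum T `<=` [set l | `|l| <= 1] ->
  (forall N, \sum_(n < N) `|g n| <= C) ->
  (forall t, 0 <= t <= 1 -> 0 < h t /\ (fun N => \sum_(n < N) g n * t ^+ n) @ \oo --> h t) ->
  (forall eps, 0 < eps -> exists N0, forall N, (N0 <= N)%N ->
     hbnd T (fun n => if (n < N)%N then 0 else g n) eps) ->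
  exists P K, [/\ 0 <= K, hbnd T P K, forall n, 0 <= P n, 0 < P 0%N &
    forall n, 0 <= cprod P g n].
Proof.
move=> bT sT gC hP gtail.
have [linT [Mt Mt0 bndT]] := (bounded_opP T).1 bT.
have [d d0 [N1 hN1]] := prefix_lower_bound gC hP.
(* Half of d keeps the polynomial positive; a tail bound of d' / 2 gives r^- / d' the bound 1/2. *)
pose d' := d / 2; have d'0 : 0 < d' by rewrite divr_gt0.
have [N2 hN2] := gtail (d' / 2) (divr_gt0 d'0 (ltr0Sn _ 1)).
(* The successor makes N positive, so that r_0 = 0 and hence e_0 = 0. *)
pose N := (maxn N1 N2).+1.
have NN1 : (N1 <= N)%N by rewrite leqW // leq_maxl.
have NN2 : (N2 <= N)%N by rewrite leqW // leq_maxr.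
pose r n := if (n < N)%N then 0 else g n.
pose w n := (if n == 0%N then d' else 0) + r n.
pose q : {poly R} := \poly_(i < N) g i - d'%:P.
have qpos t : 0 <= t <= 1 -> 0 < q.[t].
  move=> t01; rewrite !hornerE horner_poly subr_gt0.
  by apply: lt_le_trans (hN1 N t NN1 t01); rewrite /d'; lra.
have gE : g = fun n => q`_n + w n.
  apply/funext => n; rewrite coefB coefC coef_poly /w /r.
  by case: (n < N)%N; rewrite ?addr0 ?subrK // sub0r addrA addNr add0r.
have [p [[Kp Kp0 pK] pge p0 pq]] := @positive_poly_multiplier R
  (fun f => exists2 K, 0 <= K & hbnd T f K)
  (fun f1 f2 '(ex_intro2 K1 K10 h1) '(ex_intro2 K2 K20 h2) =>
     ex_intro2 _ _ (K1 * K2) (mulr_ge0 K10 K20) (hbnd_cprod K20 h1 h2))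
  (fun p => hbnd_poly p Mt0 bndT) (fun z => hbnd_geometric bT sT) q qpos.
pose e n := Num.max 0 (- r n) / d'.
have r0 : r 0%N = 0 by [].
have e0 : e 0%N = 0 by rewrite /e r0 oppr0 maxxx mul0r.
have ege n : 0 <= e n by rewrite divr_ge0 ?le_max ?lexx // ltW.
have eb : hbnd T e 2^-1.
  have h1 : hbnd T (fun n => d'^-1 * r n) (`|d'^-1| * (d' / 2)).
    by apply: hbnd_scale; exact: hN2.
  rewrite gtr0_norm ?invr_gt0 // mulrA mulVf ?gt_eqF // mul1r in h1.
  apply: hbnd_le h1 => n; rewrite /e mulrC !normrM ler_wpM2l //.
  by rewrite -[X in _ <= X]normrN; have [_|_] := leP 0 (- r n); rewrite ?normr0.
have [s [s0 sge sS]] := cprod_inverse e0 ege.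
have sb := hbnd_inverse ege eb s0 sge e0 sS.
have swge n : 0 <= cprod s w n.
  pose rp n := Num.max 0 (r n).
  have rpge k : 0 <= rp k by rewrite le_max lexx.
  (* That is w = d' (1 - e) + r^+, so s w = d' + s r^+. *)
  have wE : w = fun k => ((if k == 0%N then d' else 0) - d' * e k) + rp k.
    apply/funext => k; rewrite /w /e /rp -addrA; congr (_ + _).
    rewrite mulrC divfK ?gt_eqF //.
    by case: (leP 0 (r k)) => rk; case: (leP 0 (- r k)) => rk'; lra.
  rewrite wE cprodDr; apply: addr_ge0; last exact: cprod_ge0.
  rewrite cprodC /cprod; case: n => [|n].
    by rewrite big_ord1 /= e0 mulr0 subr0 mulr_ge0 // ltW.
  rewrite (_ : \sum_(k < _) _ = d' * s n.+1 - d' * cprod e s n.+1); first by rewrite sS subrr.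
  rewrite /cprod big_ord_recl [X in _ = _ - _ * X]big_ord_recl /=.
  rewrite e0 mulr0 subr0 mul0r add0r subn0; congr (_ + _).
  by rewrite mulr_sumr -sumrN; apply: eq_bigr => k _ /=; rewrite sub0r mulNr -mulrA.
exists (cprod s p), (2 * Kp); split.
- exact: mulr_ge0.
- exact: hbnd_cprod.
- exact: cprod_ge0.
- by rewrite cprod_at0 s0 mul1r.
(* With P = s p, the product is P g = s (p q) + p (s w). *)
- move=> n; rewrite gE cprodDr; apply: addr_ge0.
    by rewrite -cprodA; exact: cprod_ge0.
  by rewrite (cprodC s) -cprodA; exact: cprod_ge0.
Qed.

End Multiplier.

(** * Uniqueness and products of power series *)

Section PowerSeries.
Variable R : realType.
Implicit Types (b f g : nat -> R) (c : nat -> R[i]) (z w : R[i]).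

(** Convergence at 1/2 gives |b_k| <= B 2^k. If the coefficients before m vanish, the terms after
    the m-th are O(t^(m+1)), so b_m = O(t) as t tends to 0. *)
Lemma power_series_eq0 b : (forall t : R, 0 < t < 1 ->
  (fun N => \sum_(k < N) b k * t ^+ k) @ \oo --> (0 : R)) -> forall n, b n = 0.
Proof.
move=> hb; pose S t N := \sum_(k < N) b k * t ^+ k.
have [B B0 hB] : exists2 B, 0 < B & forall k, `|b k| <= B * 2 ^+ k.
  have half : 0 < (2^-1 : R) < 1 by apply/andP; split; lra.
  have /cvgrPdist_le /(_ 1 ltr01) [N _ hN] := hb _ half.
  pose B := 2 + \sum_(k < N) `|b k|.
  have B2 : 2 <= B by rewrite lerDl sumr_ge0.
  exists B => [|k]; first by lra.
  have k1 : 1 <= 2 ^+ k :> R by rewrite exprn_ege1 // ler1n.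
  have [kN|Nk] := ltnP k N.
    apply: le_trans (_ : B <= _); last by rewrite ler_peMr //; lra.
    rewrite /B (bigD1 (Ordinal kN)) //= addrCA lerDl addr_ge0 // sumr_ge0 //.
  have := hN k Nk; have := hN k.+1 (leqW Nk).
  rewrite /= !sub0r !normrN big_ord_recr /= => h1 h2.
  have h3 : `|b k * 2^-1 ^+ k| <= 2.
    have := ler_normB (\sum_(i < k) b i * 2^-1 ^+ i + b k * 2^-1 ^+ k) (\sum_(i < k) b i * 2^-1 ^+ i).
    by rewrite addrC addrA addNr add0r; lra.
  move: h3; rewrite normrM exprVn (@ger0_norm _ (2 ^- k)) ?invr_ge0 ?exprn_ge0 //.
  rewrite ler_pdivrMr ?exprn_gt0 // => h3; apply: le_trans h3 _.
  by apply: ler_wpM2r => //; lra.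
elim/ltn_ind => m IH.
have bm t : 0 < t <= 4^-1 -> `|b m| <= B * 2 ^+ m * 4 * t.
  move=> /andP[t0 t4].
  have t1 : 0 < t < 1 by rewrite t0 /=; lra.
  have geo n : \sum_(i < n) (2 * t) ^+ i <= 2.
    suff : \sum_(i < n) (2 * t) ^+ i * (1 - 2 * t) <= 1.
      rewrite -mulr_suml => h; have : 0 <= \sum_(i < n) (2 * t) ^+ i.
        by apply: sumr_ge0 => i _; rewrite exprn_ge0 // mulr_ge0 // ltW.
      by nra.
    have -> : \sum_(i < n) (2 * t) ^+ i * (1 - 2 * t) = 1 - (2 * t) ^+ n.
      elim: n => [|n IHn]; first by rewrite big_ord0 expr0 subrr.
      by rewrite big_ord_recr /= IHn exprS; ring.
    by rewrite gerBl exprn_ge0 // mulr_ge0 // ltW.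
  suff : `|b m * t ^+ m - 0| <= B * 2 ^+ m * 4 * t * t ^+ m.
    rewrite subr0 normrM (ger0_norm (exprn_ge0 _ (ltW t0))).
    by rewrite ler_pM2r // exprn_gt0.
  apply: (@cvg_norm_le _ (fun N => b m * t ^+ m - S t N) _ _ m.+1).
    by apply: cvgB; [exact: cvg_cst | exact: hb].
  move=> N mN.
  have -> : S t N = b m * t ^+ m + \sum_(m.+1 <= k < N) b k * t ^+ k.
    rewrite /S (sum_prefix_split (fun k => b k * t ^+ k) mN) big_ord_recr /= big1 ?add0r //.
    by move=> i _; rewrite IH ?mul0r.
  rewrite opprD addrA subrr sub0r normrN.
  apply: le_trans (ler_norm_sum _ _ _) _.
  apply: (@le_trans _ _ (\sum_(m.+1 <= k < N) B * 2 ^+ k * t ^+ k)).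
    apply: ler_sum => k _; rewrite normrM (ger0_norm (exprn_ge0 _ (ltW t0))).
    by rewrite ler_wpM2r // exprn_ge0 // ltW.
  have -> : \sum_(m.+1 <= k < N) B * 2 ^+ k * t ^+ k =
      B * (2 * t) ^+ m.+1 * \sum_(i < N - m.+1) (2 * t) ^+ i.
    rewrite -{1}(add0n m.+1) big_addn big_mkord mulr_sumr; apply: eq_bigr => i _.
    by rewrite -!mulrA -exprMn addnC exprD.
  have h0 : 0 <= B * (2 * t) ^+ m.+1.
    by rewrite mulr_ge0 ?exprn_ge0 ?mulr_ge0 // ltW.
  apply: le_trans (ler_wpM2l h0 (geo _)) _.
  by rewrite exprS exprMn le_eqVlt; apply/orP; left; apply/eqP; ring.
apply/eqP; rewrite -normr_le0 leNgt; apply/negP => b0.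
pose D := B * 2 ^+ m * 4; have D0 : 0 < D by rewrite !mulr_gt0 ?exprn_gt0.
have d0 : 0 < `|b m| / (2 * D) by rewrite divr_gt0 // mulr_gt0.
have := bm (Num.min 4^-1 (`|b m| / (2 * D))).
rewrite lt_min d0 invr_gt0 ltr0n ge_min lexx => /(_ isT).
rewrite -/D => h; have : `|b m| <= D * (`|b m| / (2 * D)).
  by apply: le_trans h _; rewrite ler_pM2l // ge_min lexx orbT.
have -> : D * (`|b m| / (2 * D)) = `|b m| / 2 by field; rewrite gt_eqF.
by lra.
Qed.

(** Complex convergence is tested on the functionals Re (w z), which moves limits to [R]; w = 1 and
    w = - i recover both parts. *)
Lemma sums_to_weakP c (t : R[i]) z : sums_to c t z <->
  forall w, (fun N => complex.Re (w * \sum_(k < N) c k * t ^+ k)) @ \oo --> complex.Re (w * z).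
Proof.
have sE N : series (fun n => c n * t ^+ n) N = \sum_(k < N) c k * t ^+ k.
  by rewrite /series /= big_mkord.
split=> [/cvgrPdist_le h w|h]; last first.
  apply/cvgrPdist_le => e e0.
  have eE : e = (complex.Re e)%:C by rewrite RRe_real // gtr0_real.
  move: e0; rewrite eE ltcR; set d := complex.Re e => d0.
  have d2 : 0 < d / 2 by rewrite divr_gt0.
  have /cvgrPdist_le /(_ _ d2) [N1 _ h1] := h 1.
  have /cvgrPdist_le /(_ _ d2) [N2 _ h2] := h (- 'i%C).
  exists (maxn N1 N2) => // n /=; rewrite geq_max => /andP[n1 n2].
  rewrite sE -[`|_|]RRe_real ?normr_real // lecR.
  have := h1 n n1; have := h2 n n2; rewrite /= -!ReN -!ReD -!mulrBr mul1r.
  move: (z - _) => [x y].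
  have -> : complex.Re (- 'i%C * (x +i* y)) = y by rewrite /=; ring.
  by move=> /= hy hx; apply: le_trans (Re_normc_le x y) _; lra.
apply/cvgrPdist_le => e e0; set M := complex.Re `|w| + 1.
have M0 : 0 < M by rewrite ltr_wpDl // Re_normc_ge0.
have d0 : 0 < (e / M)%:C by rewrite ltcR divr_gt0.
have [N _ hN] := h _ d0; exists N => // n /hN /=.
rewrite sE -ReN -ReD -mulrBr -[`|_ - _|]RRe_real ?normr_real // lecR => hn.
apply: le_trans (normr_Re_le _) _; rewrite normrM.
rewrite -[`|w|]RRe_real ?normr_real // Re_rM.
have n0 : 0 <= complex.Re `|z - \sum_(k < n) c k * t ^+ k| := Re_normc_ge0 _.
apply: (@le_trans _ _ (M * (e / M))); last by rewrite mulrC divfK // gt_eqF.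
by apply: ler_pM => //; rewrite /M ?lerDl // Re_normc_ge0.
Qed.

(** [taylor] picks some sequence representing [h]; comparison at real points of ]0, 1[ identifies
    it. *)
Lemma taylor_unique (h : R[i] -> R[i]) c :
  (forall t : R[i], `|t| < 1 -> sums_to c t (h t)) -> taylor h = c.
Proof.
move=> hc.
have ht : forall t : R[i], `|t| < 1 -> sums_to (taylor h) t (h t).
  by apply: (@getPex _ [set c : nat -> R[i]^o | forall t, `|t| < 1 -> sums_to c t (h t)]); exists c.
have Re0 w n : complex.Re (w * (taylor h n - c n)) = 0.
  apply: (@power_series_eq0 (fun n => complex.Re (w * (taylor h n - c n)))) => t /andP[t0 t1].
  have tC : `|t%:C| < 1 by rewrite normcR ltcR gtr0_norm.
  rewrite (_ : (fun N => _) = fun N =>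
    complex.Re (w * \sum_(k < N) taylor h k * t%:C ^+ k) -
    complex.Re (w * \sum_(k < N) c k * t%:C ^+ k)); last first.
    apply/funext => N; rewrite -ReN -ReD -mulrBr -sumrB mulr_sumr.
    elim: N => [|N IH]; first by rewrite !big_ord0.
    rewrite !big_ord_recr /= IH ReD; congr (_ + _).
    by rewrite -mulrBl mulrA -rmorphXn [X in _ = complex.Re X]mulrC Re_rM [RHS]mulrC.
  rewrite -[X in _ --> X](subrr (complex.Re (w * h t%:C))).
  by apply: cvgB; [exact: (sums_to_weakP _ _ _).1 (ht _ tC) w |
    exact: (sums_to_weakP _ _ _).1 (hc _ tC) w].
apply/funext => n; apply/eqP; rewrite -subr_eq0.
have := Re0 1 n; have := Re0 (- 'i%C) n; case: (_ - _) => x y.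
rewrite mul1r /= => h1 h2; rewrite eq_complex /= h2 eqxx /=.
by apply/eqP; rewrite -h1; ring.
Qed.

Lemma sums_to_cprod f g (Cf Cg : R) (t : R[i]) z w : `|t| <= 1 ->
  (forall N, \sum_(n < N) `|f n| <= Cf) -> (forall N, \sum_(n < N) `|g n| <= Cg) ->
  sums_to (fun n => (f n)%:C) t z -> sums_to (fun n => (g n)%:C) t w ->
  sums_to (fun n => (cprod f g n)%:C) t (z * w).
Proof.
move=> t1 hf hg /sums_to_weakP fz /sums_to_weakP gw; apply/sums_to_weakP => v.
pose u n := complex.Re (v * t ^+ n).
have sumE (a : nat -> R) (y : R[i]) N :
    complex.Re (y * \sum_(n < N) (a n)%:C * t ^+ n) = \sum_(n < N) a n * complex.Re (y * t ^+ n).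
  elim: N => [|N IH]; first by rewrite !big_ord0 mulr0.
  by rewrite !big_ord_recr /= mulrDr ReD IH mulrCA Re_rM.
have ub n : `|u n| <= complex.Re `|v|.
  rewrite -lecR; apply: le_trans (normc_ge_Re _) _.
  rewrite RRe_real ?normr_real // normrM normrX ler_piMr // exprn_ile1 //.
have v0 : 0 <= complex.Re `|v| := Re_normc_ge0 _.
pose F k m := f k * g m * u (k + m)%N.
have h : (fun N => \sum_(k < N) f k * complex.Re (v * w * t ^+ k) -
    \sum_(k < N) \sum_(m < N - k) F k m) @ \oo --> (0 : R).
  apply: (@cvg_sum_triangle R F (fun k => f k * complex.Re (v * w * t ^+ k))
    (Cf * (Cg * complex.Re `|v|))).
    move=> N; have Cg0 : 0 <= Cg by apply: le_trans (hg 0%N); rewrite big_ord0.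
    apply: (@le_trans _ _ (\sum_(k < N) `|f k| * (Cg * complex.Re `|v|))).
      apply: ler_sum => k _.
      apply: (@le_trans _ _ (\sum_(m < N) `|f k| * (`|g m| * complex.Re `|v|))).
        apply: ler_sum => m _; rewrite /F normrM normrM -mulrA ler_wpM2l //.
        by rewrite ler_wpM2l.
      by rewrite -mulr_sumr -mulr_suml ler_wpM2l // ler_wpM2r.
    by rewrite -mulr_suml ler_wpM2r ?mulr_ge0.
  move=> k; rewrite (_ : (fun M => _) =
      fun M => f k * complex.Re ((v * t ^+ k) * \sum_(m < M) (g m)%:C * t ^+ m)); last first.
    apply/funext => M; rewrite sumE mulr_sumr; apply: eq_bigr => m _.
    by rewrite /F /u exprD -!mulrA.
  by apply: cvgM; [exact: cvg_cst | rewrite mulrAC; exact: gw].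
rewrite [z * w]mulrC mulrA -[complex.Re _]subr0 (_ : (fun N => _) = fun N =>
  complex.Re (v * w * \sum_(n < N) (f n)%:C * t ^+ n) -
  (\sum_(k < N) f k * complex.Re (v * w * t ^+ k) -
    \sum_(k < N) \sum_(m < N - k) F k m)); last first.
  by apply/funext => N; rewrite (sumE (cprod f g)) sumE (sum_cprod f g u) opprB addrC subrK.
exact: cvgB (fz (v * w)) h.
Qed.

Lemma wiener_coef (h : R[i] -> R[i]) : wiener h -> real_coef h ->
  exists a : nat -> R, [/\ taylor h = (fun n => (a n)%:C),
    exists C, forall N, \sum_(n < N) `|a n| <= C &
    forall t : R[i], `|t| <= 1 -> sums_to (fun n => (a n)%:C) t (h t)].
Proof.
move=> [hs hc] hr; exists (fun n => complex.Re (taylor h n)).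
have tE : taylor h = (fun n => (complex.Re (taylor h n))%:C).
  by apply/funext => n; rewrite RRe_real //; exact: hr.
split=> //; last by move=> t t1; have := hs t t1; rewrite {1}tE.
exists (limn (series (fun n => complex.Re `|taylor h n|))) => N.
have nd : {homo series (fun n => complex.Re `|taylor h n|) : m n / (m <= n)%N >-> m <= n}.
  by apply: nondecreasing_series => n _ _; rewrite Re_normc_ge0.
apply: le_trans (nondecreasing_cvgn_le nd hc N).
rewrite /series /= big_mkord; apply: ler_sum => n _.
exact: normr_Re_le.
Qed.

End PowerSeries.

Lemma cvg_eq_lim (R : realType) (u v : nat -> R) (l m : R) :
  u @ \oo --> l -> v @ \oo --> m -> (forall n, u n = v n) -> l = m.
Proof.
by move=> ul vm uv; rewrite (_ : u = v) in ul; [exact: (cvg_unique _ ul vm)|exact/funext].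
Qed.

(** * The operator classes expressed by scalar bounds *)

Section Classes.
Variables (R : realType) (H : completeNormedModType R[i]).
Variable dot : {dot H for Num.conj}.
Hypothesis hdot : inner_product_norm dot.
Variable T : H -> H.
Hypothesis bT : bounded_op T.

(** With coefficients |a_n| the forms of the partial sums increase, so they stay below the form of
    the limit. *)
Lemma hbnd_of_sot_cvg (a : nat -> R) :
  sot_cvg (hereditary_sum dot (fun n => `|(a n)%:C|) T) -> exists2 K, 0 < K & hbnd T a K.
Proof.
move=> [A [/bounded_opP [linA [M M0 bA]] hA]]; exists (M + 1); first by rewrite ltr_wpDl.
move=> x N.
have cE n : `|(a n)%:C| = `|a n|%:C by rewrite normcR.
have lim1 := cvg_rdot hdot (y := x) (hA x).
have lim2 : (fun n => \sum_(k < n) `|a k| * rnorm (iter k T x) ^+ 2) @ \oo --> rdot dot (A x) x.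
  rewrite (_ : (fun n => _) =
    fun n => rdot dot (hereditary_sum dot (fun n => `|(a n)%:C|) T n x) x) //.
  apply/funext => n; rewrite (rdot_hereditary_sum hdot bT _ _ _ cE).
  by apply: eq_bigr => k _; rewrite (rdotxx hdot).
apply: (@le_trans _ _ (rdot dot (A x) x)).
  apply: (cvgr_to_ge lim2); exists N => // n /= Nn.
  by apply: (@ler_sum_prefix _ (fun k => `|a k| * rnorm (iter k T x) ^+ 2)) => // k;
    rewrite mulr_ge0 ?sqr_ge0.
apply: le_trans (ler_norm _) (le_trans (rdot_le hdot _ _) _).
have := bA x; have := rnorm_ge0 x; have := rnorm_ge0 (A x); nra.
Qed.

Lemma op_normP (D : H -> H) : bounded_op D -> bnd D (op_norm D).
Proof.
move=> /bounded_opP [linD [M M0 bD]] x.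
have hs : has_sup [set complex.Re `|D y| | y in [set y | `|y| <= 1]].
  split; first by exists (complex.Re `|D 0|), 0 => //=; rewrite normr0.
  exists M => _ [y /= y1 <-]; rewrite -/(rnorm _).
  apply: le_trans (bD y) _; rewrite ler_piMr //.
  by move: y1; rewrite rnormE lecR.
have [->|x0] := eqVneq x 0; first by rewrite (linear_fun0 linD) rnorm0 mulr0.
have nx : 0 < rnorm x.
  by rewrite lt_def rnorm_ge0 andbT; apply: contra_neq x0; exact: rnorm_eq0.
have : rnorm (D ((rnorm x)^-1%:C *: x)) <= op_norm D.
  apply: ub_le_sup; first by case: hs.
  exists ((rnorm x)^-1%:C *: x) => //=.
  by rewrite rnormE rnormZr gtr0_norm ?invr_gt0 // mulVf ?gt_eqF.
by rewrite (linear_funZ linD) rnormZr gtr0_norm ?invr_gt0 // ler_pdivrMl // mulrC.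
Qed.

(** Norm convergence yields, beyond [hbnd], tails that are small uniformly in x: a tail is the form
    of a difference of two partial sums. *)
Lemma norm_cvg_bounds (a : nat -> R) :
  norm_cvg (hereditary_sum dot (fun n => `|(a n)%:C|) T) ->
  (exists2 K, 0 < K & hbnd T a K) /\
  forall eps, 0 < eps -> exists N0, forall N, (N0 <= N)%N ->
     hbnd T (fun n => if (n < N)%N then 0 else a n) eps.
Proof.
set P := hereditary_sum _ _ _; move=> [A [bA PA]].
have bD n : bounded_op (fun x => P n x - A x).
  have [linA [M M0 bndA]] := (bounded_opP A).1 bA.
  have [linP [M' M'0 bndP]] : linear (P n) /\ exists2 M, 0 <= M & bnd (P n) M.
    exact/bounded_opP/hereditary_sum_bounded.
  apply/bounded_opP; split.
    by move=> c x y; rewrite linP linA scalerBr opprD addrACA.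
  exists (M' + M); first exact: addr_ge0.
  by move=> x; apply: le_trans (ler_rnormB _ _) _; rewrite mulrDl lerD.
have PAx x : (fun n => P n x) @ \oo --> A x.
  apply: (cvg_rnorm0 (v := fun n => op_norm (fun y => P n y - A y) * rnorm x)).
    by move=> n; exact: (op_normP (bD n)).
  by rewrite -[X in _ --> X](mul0r (rnorm x)); apply: cvgM; [exact: PA | exact: cvg_cst].
split; first by apply: hbnd_of_sot_cvg; exists A.
move=> eps eps0; have e2 : 0 < eps / 2 by rewrite divr_gt0.
move/cvgrPdist_le: PA => /(_ _ e2) [N0 _ hN0]; exists N0 => N NN x M.
have cE n : `|(a n)%:C| = `|a n|%:C by rewrite normcR.
pose v k := `|a k| * rnorm (iter k T x) ^+ 2.
have v0 k : 0 <= v k by rewrite mulr_ge0 ?sqr_ge0.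
pose M' := maxn N M.
pose v' k := `|if (k < N)%N then 0 else a k| * rnorm (iter k T x) ^+ 2.
apply: (@le_trans _ _ (\sum_(N <= k < M') v k)).
  apply: (@le_trans _ _ (\sum_(k < M') v' k)).
    by apply: (@ler_sum_prefix _ v'); [move=> k; rewrite mulr_ge0 ?sqr_ge0 | exact: leq_maxr].
  rewrite (sum_prefix_split v' (leq_maxl N M)) big1 ?add0r.
    by apply: ler_sum_nat => k /andP[Nk _]; rewrite /v' ltnNge Nk.
  by move=> k _; rewrite /v' ltn_ord normr0 mul0r.
have vP n : \sum_(k < n) v k = rdot dot (P n x) x.
  rewrite (rdot_hereditary_sum hdot bT _ _ _ cE).
  by apply: eq_bigr => k _; rewrite (rdotxx hdot).
have -> : \sum_(N <= k < M') v k = rdot dot (P M' x - P N x) x.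
  by rewrite rdotBl -!vP (sum_prefix_split v (leq_maxl N M)) addrAC subrr add0r.
apply: le_trans (ler_norm _) (le_trans (rdot_le hdot _ _) _).
rewrite expr2 mulrA; apply: ler_wpM2r; first exact: rnorm_ge0.
have close n : (N <= n)%N -> rnorm (P n x - A x) <= eps / 2 * rnorm x.
  move=> Nn; apply: le_trans (op_normP (bD n) x) _; apply: ler_wpM2r; first exact: rnorm_ge0.
  have := hN0 n (leq_trans NN Nn); rewrite /= sub0r normrN.
  exact: le_trans (ler_norm _).
rewrite (_ : P M' x - P N x = (P M' x - A x) - (P N x - A x)); last first.
  by rewrite opprB addrA subrK.
apply: le_trans (ler_rnormB _ _) _.
by have := close _ (leq_maxl N M); have := close _ (leqnn N); rewrite -/M'; lra.
Qed.

(** Turns [op_nonneg], which includes reality, into the sign of [hform]: symmetry of the limit makes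
    its form real. *)
Lemma hereditary_form (f : R[i] -> R[i]) (a : nat -> R) K :
  taylor f = (fun n => (a n)%:C) -> 0 < K -> hbnd T a K ->
  sot_cvg (hereditary_sum dot (taylor f) T) /\
  forall x, dot (hereditary dot f T x) x = (hform T a x)%:C.
Proof.
move=> fa K0 aK.
have cE n : taylor f n = (a n)%:C by rewrite fa.
have [A [linA bA hA fA]] := hereditary_sum_sot hdot bT cE K0 aK.
split; first by exists A; split=> //; apply/bounded_opP; split=> //; exists K => //; exact: ltW.
move=> x; have -> : hereditary dot f T x = A x.
  by apply: cvg_lim; [exact: norm_hausdorff | exact: hA].
have sA y z : rdot dot (A y) z = rdot dot y (A z).
  rewrite (rdotC dot y); apply: (cvg_eq_lim (fA y z) (fA z y)) => N.
  by apply: eq_bigr => n _; rewrite rdotC.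
have Im0 : complex.Im (dot (A x) x) = 0.
  have := dot_of_rdot linA sA x x; rewrite [RHS](dotC dot).
  by case: (dot (A x) x) => u v [] /=; lra.
apply/eqP; rewrite eq_complex /= Im0 eqxx andbT; apply/eqP.
apply: (cvg_eq_lim (fA x x) (hform_cvg aK)) => N.
by apply: eq_bigr => n _; rewrite (rdotxx hdot).
Qed.

End Classes.

(** * Similarity to an a-contraction *)

Theorem corollary1p2 (R : realType) (H : completeNormedModType R[i])
  (dot : {dot H for Num.conj}) (hdot : inner_product_norm dot)
  (hsep : separable_space H)
  (T : H -> H) (hT : bounded_op T)
  (hspec : op_spectrum T `<=` [set l | `|l| <= 1])
  (a : R) (ha : 0 < a)
  (gamma gammat : R[i] -> R[i])
  (hgamma : forall t : R[i], `|t| < 1 ->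
     gamma t = one_sub_pow a t * gammat t)
  (hpow : class_AR dot T (one_sub_pow a))
  (hgammat : class_A0R dot T gammat)
  (hpos : forall t : R, 0 <= t <= 1 -> 0 < gammat t%:C)
  (hnonneg : op_nonneg dot (hereditary dot gamma T)) :
  exists S : H -> H, op_similar T S /\ a_contraction dot a S.
Proof.
have [linT [Mt Mt0 bndT]] := (bounded_opP T).1 hT.
case: hpow => -[wpow spow] rpow; case: hgammat => -[wgam ngam] rgam.
have [al [alE [Ca hCa] als]] := wiener_coef wpow rpow.
have [g [gE [Cg hCg] gs]] := wiener_coef wgam rgam.
rewrite alE in spow; rewrite gE in ngam.
have [Ka Ka0 alK] := hbnd_of_sot_cvg hdot hT spow.
have [[Kg Kg0 gK] gtail] := norm_cvg_bounds hdot hT ngam.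
have cK := hbnd_cprod (ltW Kg0) alK gK; set c := cprod al g in cK.
(* The factorisation on the open disc determines [taylor gamma], which is therefore a Cauchy
   product. *)
have cE : taylor gamma = (fun n => (c n)%:C).
  apply: taylor_unique => t t1; rewrite hgamma //.
  by apply: (sums_to_cprod (ltW t1) hCa hCg); [apply: als | apply: gs]; exact: ltW.
have cge x : 0 <= hform T c x.
  have [_ h] := hereditary_form hdot hT cE (mulr_gt0 Ka0 Kg0) cK.
  by have := hnonneg x; rewrite h ler0c.
pose h t := complex.Re (gammat t%:C).
have hg t : 0 <= t <= 1 -> 0 < h t /\ (fun N => \sum_(n < N) g n * t ^+ n) @ \oo --> h t.
  move=> /[dup] t01 /andP[t0 t1]; split; first by have := hpos t t01; rewrite ltcE => /andP[].
  have tC : `|t%:C| <= 1 by rewrite normcR lecR ger0_norm.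
  have := (sums_to_weakP _ _ _).1 (gs _ tC) 1.
  rewrite mul1r (_ : (fun N => _) = fun N => \sum_(n < N) g n * t ^+ n) //.
  apply/funext => N; rewrite mul1r.
  elim: N => [|N IH]; first by rewrite !big_ord0.
  by rewrite !big_ord_recr /= ReD IH Re_rM -rmorphXn.
have [P [Kp [Kp0 PK Pge P0 hhge]]] := nonneg_multiplier hT hspec hCg hg gtail.
have g0 : 0 < g 0%N.
  have [h0 gh] := hg 0 (introT andP (conj (lexx 0) ler01)).
  suff gh0 : (fun N => \sum_(n < N) g n * 0 ^+ n) @ \oo --> g 0%N.
    by rewrite -(cvg_eq_lim gh gh0).
  apply/cvgrPdist_le => e e0; exists 1%N => // -[|n] //= _.
  rewrite big_ord_recl expr0 mulr1 big1 ?addr0 ?subrr ?normr0 ?(ltW e0) //.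
  by move=> i _; rewrite /bump /= expr0n mulr0.
(* The added 1 makes the bound strictly positive. *)
pose hh := cprod P g; have hhK : hbnd T hh (Kp * Kg + 1).
  move=> x N; apply: le_trans (hbnd_cprod (ltW Kg0) PK gK x N) _.
  by rewrite ler_wpM2r ?sqr_ge0 // lerDl.
have Kh0 : 0 < Kp * Kg + 1 by rewrite ltr_wpDl // mulr_ge0 // ltW.
have hh0 : 0 < hh 0%N by rewrite /hh cprod_at0 mulr_gt0.
have [B [linB bB _ fB]] := hereditary_sum_sot hdot hT (fun n => erefl (hh n)%:C) Kh0 hhK.
have BE x : rdot dot (B x) x = hform T hh x.
  apply: (cvg_eq_lim (fB x x) (hform_cvg hhK)) => N.
  by apply: eq_bigr => n _; rewrite (rdotxx hdot).
have sB x y : rdot dot (B x) y = rdot dot x (B y).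
  rewrite (rdotC dot x); apply: (cvg_eq_lim (fB x y) (fB y x)) => N.
  by apply: eq_bigr => n _; rewrite rdotC.
have hhle x : hform T hh x <= (Kp * Kg + 1) * rnorm x ^+ 2.
  apply: (cvgr_to_le (hform_cvg (x := x) hhK)); exists 0%N => // N _ /=.
  apply: le_trans (hhK x N); apply: ler_sum => n _.
  by rewrite ger0_norm //; exact: hhge.
have hhge1 x : hh 0%N * rnorm x ^+ 2 <= hform T hh x.
  apply: (cvgr_to_ge (hform_cvg (x := x) hhK)); exists 1%N => // -[|N] //= _.
  rewrite big_ord_recl lerDl; apply: sumr_ge0 => n _.
  by rewrite mulr_ge0 ?sqr_ge0 //; exact: hhge.
have [|L [Li [invL LE]]] := positive_op_factor hdot linB hh0 Kh0 sB.
  by move=> x; rewrite BE hhge1 hhle.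
have [bL bLi LK KL] := invL.
have [linL [ML ML0 bndL]] := (bounded_opP L).1 bL.
have [linLi [MLi MLi0 bndLi]] := (bounded_opP Li).1 bLi.
pose S := L \o T \o Li; exists S; split; first by exists L, Li.
have bS : bounded_op S.
  apply/bounded_opP; split; first by move=> k x y; rewrite /S /= linLi linT linL.
  exists (ML * Mt * MLi); first by rewrite !mulr_ge0.
  by apply: bnd_comp => //; [exact: mulr_ge0 | exact: bnd_comp].
have iterS n x : iter n S x = L (iter n T (Li x)).
  by elim: n => [|n IH]; rewrite /= ?KL // IH /S /= LK.
have normS n x : rnorm (iter n S x) ^+ 2 = hform T hh (iter n T (Li x)).
  by rewrite iterS LE BE.
(* Since |S^n x|^2 is the [hh]-form at T^n (Li x), the bound for [al] along T carries over to S. *)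
have alS : hbnd S al ((Kp * Kg + 1) * (Ka * MLi ^+ 2) + 1).
  move=> x N.
  apply: (@le_trans _ _ ((Kp * Kg + 1) * (Ka * rnorm (Li x) ^+ 2))).
    apply: le_trans (ler_wpM2l (ltW Kh0) (alK (Li x) N)).
    rewrite mulr_sumr; apply: ler_sum => n _.
    by rewrite normS mulrCA ler_wpM2l.
  rewrite [leRHS]mulrDl mul1r.
  apply: (@le_trans _ _ ((Kp * Kg + 1) * (Ka * MLi ^+ 2) * rnorm x ^+ 2)).
    rewrite -(mulrA (Kp * Kg + 1)) ler_pM2l // -(mulrA Ka) ler_pM2l // -exprMn.
    rewrite lerXn2r ?nnegrE ?rnorm_ge0 //.
    by rewrite mulr_ge0 ?rnorm_ge0.
  by rewrite lerDl sqr_ge0.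
have KS0 : 0 < (Kp * Kg + 1) * (Ka * MLi ^+ 2) + 1.
  by rewrite ltr_wpDl // mulr_ge0 ?(ltW Kh0) // mulr_ge0 ?(ltW Ka0) // sqr_ge0.
have [sotS formS] := hereditary_form hdot bS alE KS0 alS.
split=> // x; rewrite formS ler0c.
have -> : hform S al x = hform T (cprod al hh) (Li x).
  apply: (cvg_eq_lim (hform_cvg alS) (hform_cprod (ltW Kh0) alK hhK)) => N.
  by apply: eq_bigr => n _; rewrite normS.
(* Reordering puts P outside, so that its nonnegative coefficients multiply the nonnegative form of
   [gamma]. *)
have -> : cprod al hh = cprod P c by rewrite /hh /c !cprodA (cprodC al).
apply: (cvgr_to_ge (hform_cprod (x := Li x) _ PK cK)); first by rewrite mulr_ge0 // ltW.
exists 0%N => // N _ /=; apply: sumr_ge0 => k _; rewrite mulr_ge0 //.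
Qed.
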